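(* (a) Let $F\in H_1(G)$ and let $\{m_k:k\ge0\}$ be a sequence of positive integers such that $$\omega_{H_1}\!\left(\frac1{2^{|m_k|}},F\right)=o\!\left(\frac1{V(m_k)}\right)\quad\text{as }k\to\infty .$$ Then $\|S_{m_k}F-F\|_{H_1}\to0$ as $k\to\infty$. (b) There is an absolute constant $c>0$ such that the following holds. Let $\{m_k:k\ge0\}$ be any increasing sequence of positive integers with $\sup_{k\in\mathbb{N}}V(m_k)=\infty$. Then there exist a martingale $F\in H_1(G)$ and a subsequence $\{\alpha_k:k\ge0\}\subset\{m_k:k\ge0\}$ for which $$\omega_{H_1}\!\left(\frac1{2^{|\alpha_k|}},F\right)=O\!\left(\frac1{V(\alpha_k)}\right)\quad\text{as }k\to\infty$$ and $$\limsup_{k\to\infty}\|S_{\alpha_k}F-F\|_1>c>0 .$$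
   Context: $\mathbb{N}_+$ is the set of positive integers and $\mathbb{N}=\mathbb{N}_+\cup\{0\}$. $G=\prod_{k=0}^\infty Z_2$ is the dyadic (Walsh) group, i.e. the set of sequences $x=(x_0,x_1,\dots)$, $x_k\in\{0,1\}$, with coordinatewise addition mod 2, product topology, and normalized Haar measure $\mu$ (the product of the measures giving mass $1/2$ to each point of $Z_2$). Put $I_0(x)=G$, $I_n(x)=\{y\in G: y_0=x_0,\dots,y_{n-1}=x_{n-1}\}$, and let $\zeta_n$ be the $\sigma$-algebra generated by $\{I_n(x):x\in G\}$. For $n\in\mathbb{N}_+$ with binary expansion $n=\sum_{j\ge0}n_j2^j$, $n_j\in\{0,1\}$, put $|n|=\max\{j:n_j\neq0\}$, and let the variation of $n$ be $V(n)=n_0+\sum_{k=1}^\infty|n_k-n_{k-1}|$. Rademacher functions: $r_k(x)=(-1)^{x_k}$. Walsh functions: $w_n(x)=\prod_{k\ge0}r_k(x)^{n_k}$, $n\in\mathbb{N}$. A martingale $F=(F_n,n\in\mathbb{N})$ is a martingale with respect to $(\zeta_n)_{n\in\mathbb N}$. Its maximal function is $F^*=\sup_n|F_n|$; $H_1(G)$ is the space of martingales with $\|F\|_{H_1}:=\|F^*\|_1<\infty$, where $\|f\|_1=\int_G|f|\,d\mu$. Walsh–Fourier coefficients of a martingale: $\widehat F(k)=\lim_{n\to\infty}\int_GF_nw_k\,d\mu$ (the limit always exists). Partial sums: $S_nF=\sum_{k=0}^{n-1}\widehat F(k)w_k$; in particular $S_{2^n}F=F_n$. An integrable function $f$ (such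 as $S_nF$) is identified with the martingale $(E(f\mid\zeta_n))_{n}$ of its conditional expectations; conversely each $F\in H_1(G)$ is of this form for a unique integrable function (its a.e. and $L_1$ limit), with which it is identified when its $L_1$-norm is taken. The modulus of continuity in $H_1(G)$ is $\omega_{H_1}(1/2^n,F):=\|F-S_{2^n}F\|_{H_1}$. *)

(* Defs.v *)
From HB Require Import structures.
From mathcomp Require Import all_boot all_order all_algebra.
From mathcomp Require Import all_classical all_reals all_analysis.
From mathcomp Require Import measurable_realfun.

Set Implicit Arguments.
Unset Strict Implicit.
Unset Printing Implicit Defensive.

Import Order.TTheory GRing.Theory Num.Theory.
Import numFieldNormedType.Exports.

Local Open Scope classical_set_scope.
Local Open Scope ring_scope.

Definition digit (n j : nat) : nat := ((n %/ 2 ^ j) %% 2)%N.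

Lemma digit_ge (n j : nat) : (n <= j)%N -> digit n j = 0%N.
Proof.
move=> nj; rewrite /digit divn_small ?mod0n//.
by apply: leq_ltn_trans nj _; exact: ltn_expl.
Qed.

(** By [digit_ge] all nonzero digits of [n] have index [< n], so in the next
    two definitions and in [walsh] below finite index ranges lose nothing. *)
Definition top_digit (n : nat) : nat := \max_(j < n | digit n j != 0%N) j.

Definition binary_variation (n : nat) : nat :=
  (digit n 0 + \sum_(1 <= k < n.+1) `|digit n k - digit n k.-1|)%N.

(** [cantor_space] is the product of countably many discrete copies of [bool],
    a coordinate [true] standing for [1] in Z_2; it carries its Borel sets. *)
Notation dyadic := (g_sigma_algebraType (@open cantor_space)).

Definition cyl (n : nat) (x : dyadic) : set dyadic :=
  [set y | forall k, (k < n)%N -> y k = x k].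

Definition zeta (n : nat) : set (set dyadic) := <<s range (cyl n) >>.

(** The normalized Haar measure, as the product of the measures giving mass
    1/2 to each point of Z_2; see [haar_exists]. *)
Definition is_haar (R : realType) (mu : probability dyadic R) : Prop :=
  forall n x, mu (cyl n x) = (2^-1 ^+ n)%:E.

Section definitions.
Context {R : realType} (mu : probability dyadic R).
Implicit Types (f g : dyadic -> R) (F : nat -> dyadic -> R).

Definition rademacher (k : nat) (x : dyadic) : R := (-1) ^+ (x k).

Definition walsh (n : nat) (x : dyadic) : R :=
  \prod_(k < n) rademacher k x ^+ digit n k.

(** [g] is a version of the conditional expectation E(f | zeta_n). *)
Definition is_condexp (n : nat) f g : Prop :=
  [/\ forall B, measurable B -> zeta n (g @^-1` B),
      mu.-integrable setT (EFin \o g) &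
      forall A, zeta n A ->
        (\int[mu]_(x in A) (g x)%:E = \int[mu]_(x in A) (f x)%:E)%E].

(** The value of E(f | zeta_n) on the atom of zeta_n containing [x]; that this
    is the conditional expectation is [condexpP] and [condexp_unique]. *)
Definition condexp f (n : nat) (x : dyadic) : R :=
  (\int[mu]_(y in cyl n x) f y) / fine (mu (cyl n x)).

Definition martingale F : Prop := forall n, is_condexp n (F n.+1) (F n).

Definition maximal_fun F (x : dyadic) : \bar R :=
  ereal_sup (range (fun n => `|F n x|%:E)).

Definition H1norm F : \bar R := (\int[mu]_x maximal_fun F x)%E.

Definition H1 F : Prop := martingale F /\ (H1norm F < +oo)%E.

Definition walsh_coef F (k : nat) : R :=
  limn (fun n => \int[mu]_x (F n x * walsh k x)).

Definition partial_sum (n : nat) F (x : dyadic) : R :=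
  \sum_(0 <= k < n) walsh_coef F k * walsh k x.

(** || S_n F - F ||_H1, where the function S_n F is identified with the
    martingale of its conditional expectations. *)
Definition H1dist (n : nat) F : \bar R :=
  H1norm (fun j x => condexp (partial_sum n F) j x - F j x).

(** The modulus of continuity omega_H1(1/2^n, F). *)
Definition omega_H1 (n : nat) F : \bar R :=
  H1norm (fun j x => F j x - condexp (partial_sum (2 ^ n) F) j x).

(** [f] is the integrable function with which the martingale [F] is identified. *)
Definition closed_by F f : Prop :=
  mu.-integrable setT (EFin \o f) /\ forall n, is_condexp n f (F n).

Definition L1norm f : \bar R := (\int[mu]_x `|f x|%:E)%E.

End definitions.

(** Landau relations [u_k = o(v_k)] and [u_k = O(v_k)] as k -> oo, for
    extended-real [u]. *)
Definition elittleo (R : realType) (u : nat -> \bar R) (v : nat -> R) : Prop :=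
  forall eps : R, 0 < eps ->
    \forall k \near \oo, (`|u k| <= (eps * `|v k|)%:E)%E.

Definition ebigO (R : realType) (u : nat -> \bar R) (v : nat -> R) : Prop :=
  exists C : R, \forall k \near \oo, (`|u k| <= (C * `|v k|)%:E)%E.

Definition dpoint n (s : n.-tuple bool) : dyadic := fun k => nth false s k.
Definition dprefix n (x : dyadic) : n.-tuple bool := [tuple x i | i < n].

Lemma cyl_refl n x : cyl n x x. Proof. by []. Qed.

Lemma cyl_eq n x y : cyl n x y -> cyl n x = cyl n y.
Proof.
by move=> xy; apply/seteqP; split=> z zx k kn; rewrite zx ?xy.
Qed.

Lemma cyl_sym n x y : cyl n x y -> cyl n y x.
Proof. by move=> xy k /xy. Qed.

Lemma cyl_dpoint n (s : n.-tuple bool) y :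
  cyl n (dpoint s) y <-> dprefix n y = s.
Proof.
split=> [ys|<- k kn]; last first.
  by rewrite /dpoint /dprefix (nth_map (Ordinal kn)) ?size_enum_ord// nth_enum_ord.
apply: eq_from_tnth => i; rewrite tnth_mktuple (tnth_nth false).
exact: ys.
Qed.

Lemma cyl_dprefix n x : cyl n (dpoint (dprefix n x)) = cyl n x.
Proof. by apply: cyl_eq; apply/cyl_dpoint. Qed.

Lemma open_cyl n (x : cantor_space) : @open cantor_space (cyl n x).
Proof.
elim: n => [|n IH].
  by rewrite (_ : cyl 0 x = setT); [exact: openT|apply/seteqP; split].
rewrite (_ : cyl n.+1 x = cyl n x `&` (proj n @^-1` [set x n])).
  apply: openI => //.
  by apply: open_comp; [move=> + _; exact: proj_continuous| exact: discrete_open].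
apply/seteqP; split => [y yx|y [yx1 yx2] k].
  by split => [k kn|]; [apply: yx; exact: ltnW|exact: yx].
by rewrite ltnS leq_eqVlt => /predU1P[->//|]; exact: yx1.
Qed.

Lemma measurable_cyl n x : measurable (cyl n x).
Proof. by apply: sub_sigma_algebra; exact: open_cyl. Qed.

Lemma nbhs_cyl (x : cantor_space) (U : set cantor_space) :
  nbhs x U -> exists n, cyl n x `<=` U.
Proof.
pose Fx := filter_from [set: nat] (fun n => cyl n x : set cantor_space).
have FF : Filter Fx.
  apply: filter_from_filter; first by exists 0%N.
  move=> i j _ _; exists (maxn i j) => // y yx; split=> k kn; apply: yx.
    by rewrite (leq_trans kn)// leq_maxl.
  by rewrite (leq_trans kn)// leq_maxr.
suff FxU : Fx --> x by move=> /FxU [n _]; exists n.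
apply/cvg_sup => i V.
have /= -> := @nbhsE (initial_topology (@proj nat (fun=> bool) i)) x.
move=> [W [[B oB <-] Wx] WV]; exists i.+1 => // y yx.
by apply: WV; rewrite /= /proj yx.
Qed.

Lemma zetaE n A :
  zeta n A <-> forall x y, cyl n x y -> A x -> A y.
Proof.
split.
  have sat : sigma_algebra setT
      [set B : set dyadic | forall x y, cyl n x y -> B x -> B y].
    split => [x y _ []||].
    - move=> B satB x y xy [_ nBx]; split=> // By; apply: nBx.
      exact: satB (cyl_sym xy) By.
    - by move=> B satB x y xy [i _ Bix]; exists i => //; exact: satB Bix.
  move=> zA; apply: (@smallest_sub _ _ _ _ sat) zA => _ [z _ <-] x y xy xz.
  by rewrite (cyl_eq xz).
move=> satA.
rewrite (_ : A = \bigcup_(s in [set s : n.-tuple bool | A (dpoint s)])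
   cyl n (dpoint s)).
  apply: (@fin_bigcup_measurable _ (g_sigma_algebraType (range (cyl n)))).
    exact: finite_finset.
  by move=> s _; apply: sub_sigma_algebra; exists (dpoint s).
apply/seteqP; split => [x Ax|x [s /= As sx]]; last exact: satA As.
exists (dprefix n x); last by rewrite cyl_dprefix.
by apply: satA Ax; rewrite -cyl_dprefix.
Qed.

Lemma zeta_bigsetU n A : zeta n A -> A = \big[setU/set0]_(s <-
  [seq s <- enum {: n.-tuple bool} | `[< A (dpoint s) >]]) cyl n (dpoint s).
Proof.
move=> /zetaE satA; rewrite -bigcup_seq; apply/seteqP.
split => [x Ax|x [s /=]].
  exists (dprefix n x); last by rewrite cyl_dprefix.
  rewrite /= mem_filter mem_enum andbT; apply/asboolP.
  by apply: satA Ax; rewrite -cyl_dprefix.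
rewrite mem_filter => /andP[/asboolP As _] sx; exact: satA As.
Qed.

Lemma trivIset_cyl n (D : set (n.-tuple bool)) :
  trivIset D (fun s => cyl n (dpoint s)).
Proof.
by move=> s t _ _ [x [/cyl_dpoint <- /cyl_dpoint <-]].
Qed.

Lemma measurable_zeta n A : zeta n A -> measurable A.
Proof.
by move=> /zeta_bigsetU ->; apply: bigsetU_measurable => s _; exact: measurable_cyl.
Qed.

Section condexp_lemmas.
Context {R : realType} (mu : probability dyadic R).
Hypothesis mu_haar : is_haar mu.
Implicit Types (f g : dyadic -> R).

Lemma condexp_cyl f n x y : cyl n x y -> condexp mu f n x = condexp mu f n y.
Proof. by move=> /cyl_eq xy; rewrite /condexp xy. Qed.

Lemma integral_zeta f n A : mu.-integrable setT (EFin \o f) -> zeta n A ->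
  (\int[mu]_(x in A) (f x)%:E =
   \sum_(s <- [seq s <- enum {: n.-tuple bool} | `[< A (dpoint s) >]])
      \int[mu]_(x in cyl n (dpoint s)) (f x)%:E)%E.
Proof.
move=> intf /zeta_bigsetU {1}->; rewrite integral_bigsetU_EFin//.
- by move=> s; exact: measurable_cyl.
- by rewrite filter_uniq// enum_uniq.
- exact: trivIset_cyl.
- apply/measurable_EFinP; apply: measurable_funTS.
  by apply/measurable_EFinP; exact: (measurable_int mu intf).
Qed.

Lemma fin_haar n x : mu (cyl n x) = (fine (mu (cyl n x)))%:E.
Proof. by rewrite mu_haar. Qed.

Lemma haar_gt0 n x : 0 < fine (mu (cyl n x)).
Proof. by rewrite mu_haar/= exprn_gt0// invr_gt0. Qed.

Lemma zeta_measurable_fun n g :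
  (forall B, measurable B -> zeta n (g @^-1` B)) -> measurable_fun setT g.
Proof.
by move=> zg _ B mB; rewrite setTI; exact: measurable_zeta (zg _ mB).
Qed.

Lemma condexpP n f : mu.-integrable setT (EFin \o f) ->
  is_condexp mu n f (condexp mu f n).
Proof.
move=> intf; set g := condexp mu f n.
have zg B : measurable B -> zeta n (g @^-1` B).
  by move=> mB; apply/zetaE => x y xy; rewrite /= /g (condexp_cyl f xy).
have mg := zeta_measurable_fun zg.
have intg : mu.-integrable setT (EFin \o g).
  pose M := \sum_(s : n.-tuple bool) `|g (dpoint s)|.
  apply: (@le_integrable _ _ _ mu _ measurableT _ (EFin \o cst M)).
  - exact/measurable_EFinP.
  - move=> x _ /=; rewrite lee_fin.
    have -> : g x = g (dpoint (dprefix n x)).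
      by apply: condexp_cyl; apply: cyl_sym; apply/cyl_dpoint.
    rewrite [leRHS]ger0_norm ?sumr_ge0//.
    by rewrite /M (bigD1 (dprefix n x))//= lerDl sumr_ge0.
  - exact: finite_measure_integrable_cst.
split=> // A zA; rewrite !(@integral_zeta _ n)//.
apply: eq_bigr => s _.
rewrite (eq_integral (fun=> (g (dpoint s))%:E)); last first.
  by move=> x; rewrite inE => xs; rewrite /= /g (condexp_cyl f xs).
rewrite integral_cst; last exact: measurable_cyl.
transitivity ((g (dpoint s))%:E * mu (cyl n (dpoint s)))%E; first by [].
rewrite fin_haar -EFinM /g /condexp divfK ?gt_eqF ?haar_gt0//.
rewrite /Rintegral fineK//; apply: integrable_fin_num.
  exact: measurable_cyl.
apply: integrableS intf => //; exact: measurable_cyl.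
Qed.

Lemma condexp_unique n f g : is_condexp mu n f g -> g = condexp mu f n.
Proof.
move=> [zg intg eqg]; apply/funext => x.
have cstg y : cyl n x y -> g y = g x.
  move=> xy; have /zetaE zgx : zeta n (g @^-1` [set g x]) by exact: zg.
  exact: (zgx x y xy erefl).
have := eqg (cyl n x); rewrite (eq_integral (fun=> (g x)%:E)); last first.
  by move=> y; rewrite inE => /cstg ->.
rewrite integral_cst; last exact: measurable_cyl.
rewrite /condexp /Rintegral => <-; last first.
  by apply: sub_sigma_algebra; exists x.
rewrite [X in fine X](_ : _ = (g x)%:E * (fine (mu (cyl n x)))%:E)%E; last first.
  by rewrite -fin_haar.
by rewrite -EFinM /= mulfK// gt_eqF// haar_gt0.
Qed.

End condexp_lemmas.

Section haar_exists.
Variable R : realType.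

(** The Haar measure is the image of the uniform distribution on [0, 1] under
    the binary digits map [D]; [hd n x] is the integer with digits
    x_0 to x_(n-1), most significant first. *)
Let D (t : measurableTypeR R) : dyadic := fun k => odd (Num.truncn (2 ^+ k.+1 * t)).

Let hd n (x : dyadic) : nat := iteri n (fun k j => x k + j.*2)%N 0%N.

Let truncn2 (s : R) : 0 <= s -> (Num.truncn (2 * s))./2 = Num.truncn s.
Proof.
move=> s0; have s20 : 0 <= 2 * s by rewrite mulr_ge0.
apply/esym/truncn_def; have /andP[h1 h2] := truncn_itv s20.
set m := Num.truncn (2 * s) in h1 h2 *.
have hm : (m./2).*2%:R <= 2 * s < (m./2.+1).*2%:R.
  rewrite (le_trans _ h1)/=; last first.
    by rewrite ler_nat -[leqRHS](odd_double_half m) leq_addl.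
  rewrite (lt_le_trans h2)// ler_nat -[m in leqLHS](odd_double_half m) doubleS.
  by case: (odd m).
move: hm; rewrite -!muln2 !natrM ![_%:R * 2]mulrC.
by rewrite ler_pM2l// ltr_pM2l.
Qed.

Let D_cyl n (x : dyadic) (t : R) : 0 <= t < 1 ->
  cyl n x (D t) <-> (hd n x)%:R <= 2 ^+ n * t < (hd n x).+1%:R.
Proof.
move=> /andP[t0 t1]; have pt k : 0 <= 2 ^+ k * t by rewrite mulr_ge0.
rewrite -truncn_eq//.
elim: n => [|n IH].
  split=> // _; rewrite truncn_eq// expr0 mul1r/=.
  by rewrite t0 t1.
have half : (Num.truncn (2 ^+ n.+1 * t))./2 = Num.truncn (2 ^+ n * t).
  by rewrite exprS -mulrA truncn2.
rewrite /= -/(hd n x); split=> [xt|/eqP e].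
  have /IH/eqP e : cyl n x (D t) by move=> k kn; apply: xt; exact: ltnW.
  rewrite -(odd_double_half (Num.truncn _)) half e -/(hd n x).
  by have := xt _ (ltnSn n); rewrite /D => ->.
have xn : D t n = x n.
  by rewrite /D e oddD odd_double addbF oddb.
have /IH xt : Num.truncn (2 ^+ n * t) == hd n x.
  by rewrite -half e half_bit_double.
move=> k; rewrite ltnS leq_eqVlt => /predU1P[->//|]; exact: xt.
Qed.

Let measurable_D : measurable_fun setT D.
Proof.
pose T k : set (measurableTypeR R) := \bigcup_(j in [set j | odd j])
  [set` `[j%:R / 2 ^+ k.+1, j.+1%:R / 2 ^+ k.+1[ ].
have mT k : measurable (T k).
  by apply: bigcup_measurable => j _; exact: measurable_itv.
have DT k : [set t | D t k] = T k.
  apply/seteqP; split=> [t /= Dt|t [j /= oj]].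
    exists (Num.truncn (2 ^+ k.+1 * t)) => //=.
    rewrite in_itv/= ler_pdivrMr ?ltr_pdivlMr ?exprn_gt0// mulrC.
    apply: truncn_itv; move: Dt; rewrite /D; apply: contraTT.
    rewrite -ltNge => t0.
    suff -> : Num.truncn (2 ^+ k.+1 * t) = 0%N by [].
    by apply/truncn0Pn; rewrite -ltNge mulrC (lt_trans t0).
  rewrite in_itv/= ler_pdivrMr ?ltr_pdivlMr ?exprn_gt0// mulrC => h.
  by rewrite /D (truncn_def h).
have mcyl n x : measurable (D @^-1` cyl n x).
  rewrite (_ : D @^-1` _ = \bigcap_(k in [set k | (k < n)%N])
      (if x k then T k else ~` T k)).
    by apply: bigcap_measurableType => k _; case: ifP => _//; exact: measurableC.
  apply/seteqP; split=> t /= h k /= kn; have := h k kn;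
    by case: (x k); rewrite -DT//=; case: (D t k).
apply: (@measurability _ _ _ _ setT D (@open cantor_space)) => //.
move=> _ [U oU <-]; rewrite setTI.
rewrite (_ : U = \bigcup_n \bigcup_(s in [set s : n.-tuple bool |
    cyl n (dpoint s) `<=` U]) cyl n (dpoint s)).
  rewrite preimage_bigcup; apply: bigcupT_measurable => n.
  rewrite preimage_bigcup; apply: fin_bigcup_measurable.
    exact: finite_finset.
  by move=> s _; exact: mcyl.
apply/seteqP; split=> [x Ux|x [n _ [s sU sx]]]; last exact: sU.
have [n xU] : exists n, cyl n x `<=` U.
  by apply: nbhs_cyl; apply: open_nbhs_nbhs.
by exists n => //; exists (dprefix n x); rewrite /= cyl_dprefix.
Qed.

Let hd_lt n x : (hd n x < 2 ^ n)%N.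
Proof.
elim: n => //= n IH; rewrite -/(hd n x) expnS mul2n.
have : ((hd n x).+1.*2 <= (2 ^ n).*2)%N by rewrite leq_double.
rewrite doubleS; apply: leq_trans; rewrite !ltnS -[leqRHS]add1n leq_add2r.
by case: (x n).
Qed.

Lemma haar_exists : exists mu : probability dyadic R, is_haar mu.
Proof.
pose Dm : {mfun measurableTypeR R >-> dyadic} :=
  HB.pack D (isMeasurableFun.Build _ _ _ _ D measurable_D).
exists (distribution (uniform_prob (@ltr01 R)) Dm) => n x.
have p0 : 0 < 2 ^+ n :> R by rewrite exprn_gt0.
have hE : (D @^-1` cyl n x `&` `[0, 1]) `\ 1 =
    [set` `[(hd n x)%:R / 2 ^+ n, (hd n x).+1%:R / 2 ^+ n[ ] :> set R.
  apply/seteqP; split=> t /=; rewrite !in_itv/= ler_pdivrMr// ltr_pdivlMr//.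
    move=> [[xt /andP[t0 t1]] /eqP tn1].
    by rewrite mulrC; apply/(D_cyl n x); rewrite ?t0 ?lt_neqAle ?tn1.
  rewrite mulrC => h; have [h1 h2] := andP h.
  have t0 : 0 <= t.
    by rewrite -(pmulr_rge0 _ p0) (le_trans _ h1).
  have t1 : t < 1.
    rewrite -(ltr_pM2l p0) mulr1 (lt_le_trans h2)// -natrX ler_nat.
    exact: hd_lt.
  split; last by apply/eqP; rewrite lt_eqF.
  by rewrite t0 ltW//; split=> //; apply/D_cyl; rewrite ?t0.
transitivity (uniform_prob (@ltr01 R) (D @^-1` cyl n x)); first by [].
rewrite /uniform_prob integral_uniform_pdf.
rewrite -(@integral_setD1 _ _ 1); last 2 first.
- by rewrite hE; exact: measurable_itv.
- apply/measurable_EFinP; apply: measurable_funTS.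
  exact: measurable_uniform_pdf.
rewrite (eq_integral (fun=> 1%:E)); last first.
  move=> t; rewrite inE => -[[_ /=]]; rewrite in_itv/= /uniform_pdf => -> _.
  by rewrite subr0 invr1.
rewrite hE integral_cst; last exact: measurable_itv.
rewrite mul1e; etransitivity; first exact: lebesgue_measure_itv.
rewrite /= lte_fin ltr_pM2r ?invr_gt0// ltr_nat ltnSn.
by rewrite -EFinB -mulrBl -natrB// subSnn mul1r exprVn.
Qed.

End haar_exists.

(* Main.v *)
(** Let [c_j] be the integer part of [n / 2^j] times [2^j], plus [2^j] if [n_j = 1];
    this is a multiple of [2^(j+1)]. The integers [c_j] and [c_(j+1)] differ only if
    [n_(j+1) <> n_j], and then by one dyadic block of frequencies, to which [F]
    contributes at most [E_(j+1) |F|] in modulus. Going from [c_j = 0] for large [j]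
    down to [c_0 = n + n_0] gives [|S_n F|_1 <= V(n) |F|_1]. The conditional expectations
    of [S_n F] up to level [|n|] are those of [F], and the later ones are [S_n F],
    so that [|S_n F - F|_H1 <= (V(n) + 1) omega_H1(1/2^|n|, F)], which is (a).

    For (b), take a subsequence [a_k] along which [V] at least doubles and put
    [F = sum_k (D_(2^(N_k+1)) - D_(2^N_k)) / V(a_k)] with [N_k = |a_k|] and [D] the
    Dirichlet kernel: then [omega_H1(1/2^N_k, F) <= 2 / V(a_k)], whereas
    [|S_(a_k) F - F|_1 >= |D_(2^(N_k+1)) - D_(a_k)|_1 / V(a_k)]. On the set where
    [x_(j+1)] is the first nonzero coordinate, of measure [2^-(j+2)], the kernel
    [|D_n|] is at least [2^j] as soon as [n_(j+1) <> n_j], and summing over the jumps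
    bounds the last quotient below by [(V(a_k) - 2) / (4 V(a_k))]. *)

Require Import Defs.
From mathcomp Require Import all_boot all_order all_algebra.
From mathcomp Require Import all_classical all_reals all_analysis.
From mathcomp Require Import measurable_realfun zify ring lra.

Set Implicit Arguments.
Unset Strict Implicit.
Unset Printing Implicit Defensive.

Import Order.TTheory GRing.Theory Num.Theory.
Import numFieldNormedType.Exports.

Local Open Scope classical_set_scope.
Local Open Scope ring_scope.

(** * Walsh functions *)

Lemma digit_lt2 n j : (digit n j < 2)%N.
Proof. exact: ltn_pmod. Qed.

Lemma digit_small n j : (n < 2 ^ j)%N -> digit n j = 0%N.
Proof. by move=> nj; rewrite /digit divn_small ?mod0n. Qed.

Lemma digit_small_le n i j : (n < 2 ^ i)%N -> (i <= j)%N -> digit n j = 0%N.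
Proof.
by move=> ni ij; apply/digit_small/(leq_trans ni); rewrite leq_pexp2l.
Qed.

(** The addition produces no carry, so the digits split at position [j]; this is what makes
    [walsh_block] a product formula. *)
Lemma digit_block q i j l : (i < 2 ^ j)%N ->
  digit (q * 2 ^ j + i) l = if (l < j)%N then digit i l else digit (q * 2 ^ j) l.
Proof.
move=> ij; case: ltnP => lj; rewrite /digit.
  rewrite -(subnK lj) addnS -addSn expnD mulnA divnMDl ?expn_gt0//.
  by rewrite expnS [(2 * _)%N]mulnC mulnA modnMDl.
rewrite -(subnKC lj) expnD !divnMA mulnK ?expn_gt0//.
by rewrite divnMDl ?expn_gt0// (divn_small ij) addn0.
Qed.

Lemma digit_mul_low q j l : (l < j)%N -> digit (q * 2 ^ j) l = 0%N.
Proof.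
by move=> lj; rewrite -[X in digit X _]addn0 digit_block ?expn_gt0// lj /digit div0n.
Qed.

Lemma digit_pow2 j l : digit (2 ^ j) l = (l == j).
Proof.
case: (ltngtP l j) => [lj|lj|->].
- by have := digit_mul_low 1 lj; rewrite mul1n.
- by apply: digit_small; rewrite ltn_exp2l.
- by rewrite /digit divnn expn_gt0.
Qed.

Lemma div_pow2_step n j : (n %/ 2 ^ j = 2 * (n %/ 2 ^ j.+1) + digit n j)%N.
Proof.
by rewrite expnSr divnMA mulnC /digit -divn_eq.
Qed.

Lemma mod_pow2_step n j : (n %% 2 ^ j.+1 = digit n j * 2 ^ j + n %% 2 ^ j)%N.
Proof.
have := div_pow2_step n j; have := divn_eq n (2 ^ j).
have := divn_eq n (2 ^ j.+1); rewrite expnS; nia.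
Qed.

Lemma digitE n j : digit n j = (2 ^ j <= n %% 2 ^ j.+1)%N.
Proof.
have := mod_pow2_step n j; have := ltn_pmod n (expn_gt0 2 j : (0 < 2 ^ j)%N).
case: (digit n j) (digit_lt2 n j) => [|[]]// _; case: leqP => //; lia.
Qed.

Section walsh.
Context {R : realType}.

Lemma rademacherX2 j (x : dyadic) : rademacher j x * rademacher j x = 1 :> R.
Proof. by rewrite /rademacher; case: (x j); rewrite ?expr0 ?expr1; ring. Qed.

(** Digits of [k] beyond its length only contribute factors 1. A freely chosen range lets several
    Walsh functions be compared factor by factor. *)
Lemma walsh_widen M k (x : dyadic) : (k < 2 ^ M)%N ->
  walsh k x = \prod_(j < M) rademacher j x ^+ digit k j :> R.
Proof.
move=> kM; pose m := maxn k M.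
have aux N : (forall j, (N <= j)%N -> digit k j = 0%N) -> (N <= m)%N ->
    \prod_(j < m) rademacher j x ^+ digit k j =
    \prod_(j < N) rademacher j x ^+ digit k j :> R.
  move=> kN Nm; rewrite -!(big_mkord xpredT (fun j => rademacher j x ^+ digit k j)).
  rewrite (big_cat_nat (n := N))//= [X in _ * X]big1_seq ?mulr1// => j.
  by rewrite mem_index_iota => /andP[_ /andP[Nj _]]; rewrite kN.
rewrite /walsh -(aux k) ?leq_maxl//; last by move=> j; exact: digit_ge.
by apply: aux; rewrite ?leq_maxr// => j; exact: digit_small_le.
Qed.

Lemma walsh0 (x : dyadic) : walsh 0 x = 1 :> R.
Proof. by rewrite /walsh big_ord0. Qed.

Lemma walsh_block q i j (x : dyadic) : (i < 2 ^ j)%N ->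
  walsh (q * 2 ^ j + i) x = walsh (q * 2 ^ j) x * walsh i x :> R.
Proof.
(* [M] bounds all three frequencies, and [M < 2 ^ M], so it serves as a common range. *)
move=> ij; pose M := (q * 2 ^ j + i)%N.
have lt2 k : (k <= M)%N -> (k < 2 ^ M)%N.
  by move=> kM; apply: leq_ltn_trans kM _; exact: ltn_expl.
rewrite !(@walsh_widen M) ?lt2 /M ?leq_addr ?leq_addl//.
rewrite -big_split; apply: eq_bigr => l _ /=.
rewrite digit_block// -exprD; case: ltnP => lj.
  by rewrite digit_mul_low.
by rewrite (digit_small_le ij lj) addn0.
Qed.

Lemma walsh_pow2 j (x : dyadic) : walsh (2 ^ j) x = rademacher j x :> R.
Proof.
rewrite (@walsh_widen j.+1) ?ltn_exp2l// big_ord_recr/= big1 ?mul1r.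
  by rewrite digit_pow2 eqxx expr1.
by move=> i _; rewrite digit_pow2 ltn_eqF// expr0.
Qed.

Lemma walsh_pow2D i j (x : dyadic) : (i < 2 ^ j)%N ->
  walsh (2 ^ j + i) x = rademacher j x * walsh i x :> R.
Proof. by move=> ij; rewrite -walsh_pow2 -{1 2}[(2 ^ j)%N]mul1n walsh_block. Qed.

Lemma walsh_cyl n k x y : (k < 2 ^ n)%N -> cyl n x y ->
  walsh k x = walsh k y :> R.
Proof.
move=> kn xy; rewrite !(@walsh_widen n)//; apply: eq_bigr => j _.
by rewrite /rademacher xy.
Qed.

Lemma walshX2 k (x : dyadic) : walsh k x * walsh k x = 1 :> R.
Proof.
rewrite /walsh -big_split/= big1// => j _.
by rewrite -exprMn rademacherX2 expr1n.
Qed.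

Lemma normr_walsh k (x : dyadic) : `|walsh k x| = 1 :> R.
Proof.
apply/eqP; rewrite -(@eqrXn2 _ 2)// expr1n.
by rewrite -normrX expr2 walshX2 normr1.
Qed.

Lemma cylS j (x t : dyadic) : cyl j.+1 x t <-> cyl j x t /\ t j = x j.
Proof.
split=> [xt|[xt tj] k]; first by split=> [k kj|]; apply: xt => //; exact: ltnW.
by rewrite ltnS leq_eqVlt => /predU1P[->//|]; exact: xt.
Qed.

Lemma sum_nat_pow2S (V : nmodType) (E : nat -> V) j :
  \sum_(0 <= i < 2 ^ j.+1) E i =
  \sum_(0 <= i < 2 ^ j) E i + \sum_(0 <= i < 2 ^ j) E (2 ^ j + i)%N.
Proof.
rewrite expnS mul2n -addnn (big_cat_nat (n := (2 ^ j)%N)) ?leq_addr//=; congr +%R.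
rewrite -{1}[(2 ^ j)%N]add0n big_addn addnK.
by apply: eq_bigr => i _; rewrite addnC.
Qed.

(** This is the Dirichlet kernel of order [2 ^ j] at [x + t]. Doubling the range multiplies the sum
    by [1 + r_j(x) r_j(t)], which is 2 if [x] and [t] agree at [j] and 0 otherwise. *)
Lemma walsh_kernel j (x t : dyadic) :
  \sum_(0 <= i < 2 ^ j) walsh i x * walsh i t = 2 ^+ j * \1_(cyl j x) t :> R.
Proof.
elim: j => [|j IH].
  rewrite expn0 big_nat1 !walsh0 indicE mem_set ?mulr1//.
rewrite sum_nat_pow2S [X in _ + X](eq_big_nat _ _ (F2 := fun i =>
    (rademacher j x * rademacher j t) * (walsh i x * walsh i t))); last first.
  by move=> i /andP[_ ij]; rewrite !walsh_pow2D//; ring.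
rewrite -big_distrr/= IH exprS !indicE.
have [xt|xt] := pselect (cyl j x t); last first.
  by rewrite !memNset ?mulr0 ?addr0// => /cylS[].
rewrite (mem_set xt) /rademacher.
have [txj|txj] := eqVneq (t j) (x j).
  rewrite mem_set; last exact/cylS.
  by rewrite txj; case: (x j); rewrite ?expr0 ?expr1; ring.
rewrite memNset; last by move=> /cylS[_ /eqP]; exact/negP.
by move: txj; case: (x j); case: (t j) => //= _; rewrite ?expr0 ?expr1; ring.
Qed.

End walsh.

(** * Conditional expectations *)

(** Measurability with respect to [zeta n], expressed as constancy on its finitely many atoms. *)
Definition cyl_fun (R : realType) (n : nat) (g : dyadic -> R) : Prop :=
  forall x y, cyl n x y -> g x = g y.

Lemma cyl_le m n (x y : dyadic) : (m <= n)%N -> cyl n x y -> cyl m x y.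
Proof. by move=> mn xy k km; apply: xy; exact: leq_trans mn. Qed.

Lemma cyl_funS (R : realType) m n (g : dyadic -> R) : (m <= n)%N ->
  cyl_fun m g -> cyl_fun n g.
Proof. by move=> mn gm x y /(cyl_le mn); exact: gm. Qed.

Lemma cyl_fun_walsh (R : realType) n k : (k < 2 ^ n)%N ->
  cyl_fun n (@walsh R k).
Proof. by move=> kn x y; exact: walsh_cyl. Qed.

Lemma zeta_le m n A : (m <= n)%N -> zeta m A -> zeta n A.
Proof.
by move=> mn /zetaE mA; apply/zetaE => x y /(cyl_le mn); exact: mA.
Qed.

Lemma zeta_cyl n x : zeta n (cyl n x).
Proof. by apply: sub_sigma_algebra; exists x. Qed.

Section condexp_theory.
Context {R : realType} (mu : probability dyadic R).
Hypothesis mu_haar : is_haar mu.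
Implicit Types (f g : dyadic -> R).
Local Notation integ f := (mu.-integrable setT (EFin \o f)).

Lemma integrable_cyl f n x : integ f -> mu.-integrable (cyl n x) (EFin \o f).
Proof. by apply: integrableS => //; exact: measurable_cyl. Qed.

Lemma cyl_fun_zeta n g B : cyl_fun n g -> zeta n (g @^-1` B).
Proof. by move=> gn; apply/zetaE => x y /gn /= ->. Qed.

Lemma cyl_fun_measurable n g : cyl_fun n g -> measurable_fun setT g.
Proof.
by move=> gn; apply: (@zeta_measurable_fun _ n) => B _; exact: cyl_fun_zeta.
Qed.

Lemma cyl_fun_bounded n g : cyl_fun n g -> exists M, forall x, `|g x| <= M.
Proof.
move=> gn; exists (\sum_(s : n.-tuple bool) `|g (dpoint s)|) => x.
rewrite (gn x (dpoint (dprefix n x))); last by apply/cyl_sym/cyl_dpoint.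
by rewrite (bigD1 (dprefix n x))//= lerDl sumr_ge0.
Qed.

Lemma integrable_cyl_funM n g f : cyl_fun n g -> integ f ->
  integ (fun x => g x * f x).
Proof.
move=> gn intf; have [M gM] := cyl_fun_bounded gn.
apply: (@le_integrable _ _ _ mu _ measurableT _ (EFin \o (fun x => M * f x))).
- apply/measurable_EFinP/measurable_funM; first exact: cyl_fun_measurable gn.
  by apply/measurable_EFinP; exact: measurable_int intf.
- move=> x _ /=; rewrite lee_fin !normrM ler_wpM2r//.
  by rewrite (le_trans (gM x))// ler_norm.
- by rewrite (_ : _ \o _ = (fun x => M%:E * (f x)%:E)%E)//; exact: integrableZl.
Qed.

Lemma integrable_cyl_fun n g : cyl_fun n g -> integ g.
Proof.
move=> gn; have -> : g = (fun x => g x * cst 1 x).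
  by apply/funext => x; rewrite mulr1.
by apply: (integrable_cyl_funM gn); exact: finite_measure_integrable_cst.
Qed.

Lemma is_condexp_cyl_fun n f g : is_condexp mu n f g -> cyl_fun n g.
Proof.
by move=> /(condexp_unique mu_haar) -> x y; exact: condexp_cyl.
Qed.

Lemma cyl_fun_condexp n f : cyl_fun n (condexp mu f n).
Proof. by move=> x y; exact: condexp_cyl. Qed.

Lemma condexp_id n g : cyl_fun n g -> condexp mu g n = g.
Proof.
move=> gn; apply/esym/(condexp_unique mu_haar); split => //.
- by move=> B _; exact: cyl_fun_zeta.
- exact: integrable_cyl_fun gn.
Qed.

Lemma integrable_condexp n f : integ (condexp mu f n).
Proof. exact: (@integrable_cyl_fun n (condexp mu f n) (@cyl_fun_condexp n f)). Qed.

Lemma Rintegral_condexp n f A : integ f -> zeta n A ->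
  \int[mu]_(x in A) condexp mu f n x = \int[mu]_(x in A) f x.
Proof.
by move=> /(condexpP mu_haar n)[_ _ h] /h; rewrite /Rintegral => ->.
Qed.

Lemma condexpE n f x :
  condexp mu f n x = 2 ^+ n * \int[mu]_(y in cyl n x) f y.
Proof. by rewrite /condexp mu_haar/= exprVn invrK mulrC. Qed.

Lemma condexp_tower m n f : (m <= n)%N -> integ f ->
  condexp mu (condexp mu f n) m = condexp mu f m.
Proof.
move=> mn intf; apply/funext => x; rewrite !condexpE Rintegral_condexp//.
by apply: (zeta_le mn); exact: zeta_cyl.
Qed.

(** On the atom over which the average is taken [g] is constant and leaves the integral. *)
Lemma condexp_pull n f g : cyl_fun n g -> integ f ->
  condexp mu (fun x => g x * f x) n = fun x => g x * condexp mu f n x.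
Proof.
move=> gn intf; apply/funext => x; rewrite !condexpE.
rewrite (@eq_Rintegral _ _ _ _ _ (fun y => g x * f y)); last first.
  by move=> y; rewrite inE => /gn ->.
rewrite RintegralZl; first by rewrite mulrCA.
  exact: measurable_cyl.
exact: integrable_cyl.
Qed.

Lemma condexpD n f g : integ f -> integ g ->
  condexp mu (fun x => f x + g x) n = fun x => condexp mu f n x + condexp mu g n x.
Proof.
move=> intf intg; apply/funext => x; rewrite !condexpE RintegralD.
- by rewrite mulrDr.
- exact: measurable_cyl.
- exact: integrable_cyl.
- exact: integrable_cyl.
Qed.

Lemma condexpB n f g : integ f -> integ g ->
  condexp mu (fun x => f x - g x) n = fun x => condexp mu f n x - condexp mu g n x.
Proof.
move=> intf intg; apply/funext => x; rewrite !condexpE RintegralB.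
- by rewrite mulrBr.
- exact: measurable_cyl.
- exact: integrable_cyl.
- exact: integrable_cyl.
Qed.

Lemma integrable_normr f : integ f -> integ (fun x => `|f x|).
Proof. by move=> /integrable_abse. Qed.

Lemma ler_norm_condexp n f x : integ f ->
  `|condexp mu f n x| <= condexp mu (fun y => `|f y|) n x.
Proof.
move=> intf; rewrite !condexpE normrM ger0_norm ?exprn_ge0//.
apply: ler_wpM2l; first exact: exprn_ge0.
apply: le_normr_Rintegral; first exact: measurable_cyl.
exact: integrable_cyl.
Qed.

Lemma zetaT n : zeta n setT.
Proof. by apply/zetaE. Qed.

Lemma Rintegral_condexpT n f : integ f ->
  \int[mu]_x condexp mu f n x = \int[mu]_x f x.
Proof. by move=> intf; rewrite Rintegral_condexp//; exact: zetaT. Qed.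

Lemma Rintegral_norm_condexp n f : integ f ->
  \int[mu]_x `|condexp mu f n x| <= \int[mu]_x `|f x|.
Proof.
move=> intf; rewrite -(@Rintegral_condexpT n (fun x => `|f x|)).
  apply: le_Rintegral => //.
  - by apply: integrable_normr; exact: integrable_condexp.
  - exact: integrable_condexp.
  - by move=> x _; exact: ler_norm_condexp.
exact: integrable_normr.
Qed.

Lemma condexp_rademacher n x : condexp mu (rademacher n) n x = 0.
Proof.
(* Flipping coordinate [n] gives the other half of the atom, of equal measure, where [rademacher n]
   has the opposite sign. *)
pose x' : dyadic := fun k => if k == n then ~~ x k else x k.
have xx' : cyl n x = cyl n.+1 x `|` cyl n.+1 x'.
  apply/seteqP; split=> y.
    move=> xy; have [yn|yn] := eqVneq (y n) (x n); [left|right]; apply/cylS.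
      by split.
    split; last by rewrite /x' eqxx; move: yn; case: (x n); case: (y n).
    by move=> k kn; rewrite /x' ltn_eqF// xy.
  move=> [/cylS[]//|/cylS[xy _] k kn].
  by rewrite xy// /x' ltn_eqF.
have int1 z : \int[mu]_(y in cyl n.+1 z) rademacher n y = rademacher n z * 2^-1 ^+ n.+1.
  rewrite (@eq_Rintegral _ _ _ _ _ (cst (rademacher n z))); last first.
    by move=> y; rewrite inE => /cylS[_ yz]; rewrite /rademacher yz.
  rewrite Rintegral_cst; last exact: measurable_cyl.
  transitivity (rademacher n z * fine (mu (cyl n.+1 z))) => //.
  by rewrite mu_haar.
rewrite condexpE xx' Rintegral_setU.
- rewrite !int1 /rademacher /x' eqxx.
  by case: (x n); rewrite ?expr0 ?expr1; ring.
- exact: measurable_cyl.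
- exact: measurable_cyl.
- rewrite -xx'; apply: integrable_cyl.
  apply: (@integrable_cyl_fun n.+1) => y z /cylS[_ yz].
  by rewrite /rademacher yz.
- apply/disj_setPS => y [/cylS[_ xy] /cylS[_]].
  by rewrite xy /x' eqxx; case: (x n).
Qed.

(** If [2 ^ l] is the leading power of [k], then [w_k = w_i r_l] with [i < 2 ^ l]. At level [l] the
    factor [w_i] comes out and [r_l] averages to 0; the tower property descends to [j <= l]. *)
Lemma condexp_walsh j k : (2 ^ j <= k)%N ->
  condexp mu (@walsh R k) j = fun=> 0.
Proof.
move=> jk; have k0 : (0 < k)%N by apply: leq_trans jk; rewrite expn_gt0.
have /andP[lk kl] := trunc_log_bounds (isT : 1 < 2)%N k0; set l := trunc_log 2 k in lk kl.
have jl : (j <= l)%N.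
  by rewrite -ltnS -(@ltn_exp2l 2)//; exact: leq_ltn_trans kl.
pose i := (k - 2 ^ l)%N.
have kE : k = (2 ^ l + i)%N by rewrite /i subnKC.
have il : (i < 2 ^ l)%N by move: kl; rewrite kE expnS mul2n -addnn ltn_add2l.
have r_cyl : cyl_fun l.+1 (@rademacher R l).
  by move=> y z /cylS[_ yz]; rewrite /rademacher yz.
have wE : @walsh R k = fun x => walsh i x * rademacher l x.
  by apply/funext => x; rewrite kE walsh_pow2D// mulrC.
rewrite -(@condexp_tower j l)//; last first.
  apply: (@integrable_cyl_fun l.+1); exact: cyl_fun_walsh.
rewrite wE (@condexp_pull l); [|exact: cyl_fun_walsh|exact: integrable_cyl_fun r_cyl].
have -> : (fun x => walsh i x * condexp mu (rademacher l) l x) = fun=> 0.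
  by apply/funext => x; rewrite condexp_rademacher mulr0.
by rewrite condexp_id.
Qed.

End condexp_theory.

(** * Fourier partial sums and variation *)

Section fourier.
Context {R : realType} (mu : probability dyadic R).
Hypothesis mu_haar : is_haar mu.
Implicit Types (f g : dyadic -> R).
Local Notation integ f := (mu.-integrable setT (EFin \o f)).

(** The coefficients of one function, without a limit; [walsh_coefE] and [partial_sumE] reduce those
    of a martingale to them. *)
Definition fourier g (k : nat) : R := \int[mu]_x (g x * walsh k x).

Definition fourier_sum g (n : nat) (x : dyadic) : R :=
  \sum_(0 <= k < n) fourier g k * walsh k x.

Lemma integrable_walsh k : integ (@walsh R k).
Proof.
by apply: (@integrable_cyl_fun _ _ k); apply: cyl_fun_walsh; exact: ltn_expl.
Qed.

Lemma integrableMwalsh f k : integ f -> integ (fun x => f x * walsh k x).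
Proof.
move=> intf.
have -> : (fun x => f x * walsh k x) = (fun x => walsh k x * f x).
  by apply/funext => x; rewrite mulrC.
apply: (@integrable_cyl_funM _ _ k) => //.
by apply: cyl_fun_walsh; exact: ltn_expl.
Qed.

Lemma integrableD_EFin f g : integ f -> integ g -> integ (fun x => f x + g x).
Proof. by move=> intf intg; exact: (integrableD measurableT intf intg). Qed.

Lemma integrableB_EFin f g : integ f -> integ g -> integ (fun x => f x - g x).
Proof. by move=> intf intg; exact: (integrableB measurableT intf intg). Qed.

Lemma integrableZl_EFin c f : integ f -> integ (fun x => c * f x).
Proof. by move=> intf; exact: (integrableZl measurableT c intf). Qed.

Lemma integrable_sum_nat n (h : nat -> dyadic -> R) :
  (forall i, integ (h i)) -> integ (fun x => \sum_(0 <= i < n) h i x).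
Proof.
move=> inth; elim: n => [|n IH].
  under eq_fun do rewrite big_geq//.
  exact: finite_measure_integrable_cst.
under eq_fun do rewrite big_nat_recr//=.
exact: integrableD_EFin.
Qed.

Lemma Rintegral_sum_nat n (h : nat -> dyadic -> R) : (forall i, integ (h i)) ->
  \int[mu]_x (\sum_(0 <= i < n) h i x) = \sum_(0 <= i < n) \int[mu]_x h i x.
Proof.
move=> inth; elim: n => [|n IH].
  under eq_fun do rewrite big_geq//.
  by rewrite Rintegral_cst// mul0r big_geq.
under eq_fun do rewrite big_nat_recr//=.
by rewrite RintegralD// ?IH ?big_nat_recr//; exact: integrable_sum_nat.
Qed.

Lemma fourierB f g k : integ f -> integ g ->
  fourier (fun x => f x - g x) k = fourier f k - fourier g k.
Proof.
move=> intf intg; rewrite /fourier -RintegralB//; try exact: integrableMwalsh.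
by apply: eq_Rintegral => x _; rewrite mulrBl.
Qed.

Lemma fourier_condexp n k f : (k < 2 ^ n)%N -> integ f ->
  fourier (condexp mu f n) k = fourier f k.
Proof.
move=> kn intf; rewrite /fourier.
have wn := @cyl_fun_walsh R _ _ kn.
rewrite -(Rintegral_condexpT mu_haar n (integrableMwalsh k intf)).
apply: eq_Rintegral => x _.
have -> : (fun x => f x * walsh k x) = (fun x => walsh k x * f x).
  by apply/funext => y; rewrite mulrC.
by rewrite (condexp_pull mu_haar wn)// mulrC.
Qed.

(** Under the integral one may take the conditional expectation of level [n]: [g] comes out and
    [walsh k] averages to 0. *)
Lemma fourier_ge_eq0 n k g : cyl_fun n g -> (2 ^ n <= k)%N -> fourier g k = 0.
Proof.
move=> gn nk; rewrite /fourier.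
have intg := integrable_cyl_fun mu gn.
rewrite -(Rintegral_condexpT mu_haar n (integrableMwalsh k intg)).
rewrite (condexp_pull mu_haar gn (integrable_walsh k)).
rewrite (condexp_walsh mu_haar nk).
under eq_Rintegral do rewrite mulr0.
by rewrite Rintegral_cst// mul0r.
Qed.

Lemma fourier_sumB f g n x : integ f -> integ g ->
  fourier_sum (fun x => f x - g x) n x = fourier_sum f n x - fourier_sum g n x.
Proof.
move=> intf intg; rewrite /fourier_sum -sumrB; apply: eq_bigr => k _.
by rewrite fourierB// mulrBl.
Qed.

(** Exchanging sum and integral leaves [g] integrated against [walsh_kernel], that is, averaged over
    the atom of [x]. *)
Lemma fourier_sum_pow2 j g x : integ g ->
  fourier_sum g (2 ^ j) x = condexp mu g j x.
Proof.
move=> intg; rewrite (condexpE mu_haar) /fourier_sum.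
under eq_bigr do rewrite mulrC /fourier -RintegralZl ?integrableMwalsh//.
rewrite -Rintegral_sum_nat; last first.
  by move=> i; apply: integrableZl_EFin; exact: integrableMwalsh.
rewrite -RintegralZl//; last 2 first.
- exact: measurable_cyl.
- exact: integrable_cyl.
rewrite [RHS]Rintegral_mkcond; apply: eq_Rintegral => t _.
under eq_bigr do rewrite mulrCA.
rewrite -big_distrr/= walsh_kernel indicE patchE.
case: ifP => _ /=; first by rewrite mulr1 mulrC.
by rewrite !mulr0.
Qed.

(** The frequencies of the block are [q * 2 ^ j + i] with [i < 2 ^ j], so the block is the partial
    sum of order [2 ^ j] of a modulated [g], modulated back. *)
Lemma fourier_sum_block q j g x : integ g ->
  fourier_sum g (q.+1 * 2 ^ j) x = fourier_sum g (q * 2 ^ j) x +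
  walsh (q * 2 ^ j) x * condexp mu (fun y => g y * walsh (q * 2 ^ j) y) j x.
Proof.
move=> intg; rewrite -fourier_sum_pow2; last exact: integrableMwalsh.
rewrite /fourier_sum (big_cat_nat (n := (q * 2 ^ j)%N))//=; last first.
  by rewrite leq_mul2r leqnSn orbT.
congr +%R; rewrite -{1}[(q * 2 ^ j)%N]add0n big_addn -mulnBl subSnn mul1n.
rewrite big_distrr/=; apply: eq_big_nat => i /andP[_ ij].
rewrite addnC walsh_block// mulrCA; congr (_ * (_ * _)).
by apply: eq_Rintegral => y _; rewrite walsh_block// mulrA.
Qed.

Lemma fourier_sum_block_le q j g x : integ g ->
  `|fourier_sum g (q.+1 * 2 ^ j) x - fourier_sum g (q * 2 ^ j) x| <=
  condexp mu (fun y => `|g y|) j x.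
Proof.
move=> intg; rewrite fourier_sum_block// addrAC subrr add0r.
rewrite normrM normr_walsh mul1r.
apply: (le_trans (ler_norm_condexp mu_haar j x (integrableMwalsh _ intg))).
suff -> : (fun y => `|g y * walsh (q * 2 ^ j) y|) = (fun y => `|g y|) by [].
by apply/funext => y; rewrite normrM normr_walsh mulr1.
Qed.

Lemma condexp_norm_ge0 g n x : 0 <= condexp mu (fun y => `|g y|) n x.
Proof.
by rewrite (condexpE mu_haar) mulr_ge0 ?exprn_ge0//; apply: Rintegral_ge0.
Qed.

(** The pointwise estimate: every unit of variation costs one conditional expectation of [|g|], at
    the level of the jump. *)
Lemma fourier_sum_variation g n x : integ g ->
  `|fourier_sum g n x| <=
  (digit n 0)%:R * condexp mu (fun y => `|g y|) 0 x +
  \sum_(0 <= k < n) `|digit n k.+1 - digit n k|%N%:R *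
                    condexp mu (fun y => `|g y|) k.+1 x.
Proof.
move=> intg; set E := fun k => condexp mu (fun y => `|g y|) k x.
have E0 k : 0 <= E k by exact: condexp_norm_ge0.
(* The partial sum at the integer [c_j] of the overview. *)
pose C j := fourier_sum g ((n %/ 2 ^ j + digit n j) * 2 ^ j) x.
have step j (a d e : nat) : (d < 2)%N -> (e < 2)%N ->
    `|fourier_sum g ((a + d) * 2 ^ j) x - fourier_sum g ((a + e) * 2 ^ j) x|
    <= `|d - e|%N%:R * E j.
  case: d e => [|[]]// [|[]]// _ _; rewrite ?subrr ?normr0 ?mul0r// addn0 addn1.
    by rewrite distrC mul1r; exact: fourier_sum_block_le.
  by rewrite mul1r; exact: fourier_sum_block_le.
have Cn : C n = 0.
  have nn := ltn_expl n (isT : 1 < 2)%N.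
  by rewrite /C divn_small// digit_small// mul0n /fourier_sum big_geq.
(* With [a = n %/ 2 ^ j.+1] one has [c_j = (2 a + 2 n_j) 2^j = (a + n_j) 2^(j+1)], while
   [c_(j+1) = (a + n_(j+1)) 2^(j+1)]; so [step] applies at level [j.+1]. *)
have CC j : `|C j - C j.+1| <= `|digit n j.+1 - digit n j|%N%:R * E j.+1.
  rewrite /C [(n %/ 2 ^ j)%N]div_pow2_step -addnA addnn -mul2n -mulnDr.
  rewrite [(2 * _)%N]mulnC -mulnA -expnS distrC.
  by apply: step; exact: digit_lt2.
have telescope k : `|C 0%N - C k| <=
    \sum_(0 <= j < k) `|digit n j.+1 - digit n j|%N%:R * E j.+1.
  elim: k => [|k IH]; first by rewrite subrr normr0 big_geq.
  rewrite big_nat_recr//=; apply: le_trans (lerD IH (CC k)).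
  by rewrite -[C 0%N - _](subrKA (C k)) ler_normD.
rewrite -[fourier_sum g n x](subrK (C 0%N)).
apply: (le_trans (ler_normD _ _)); apply: lerD.
  rewrite /C expn0 divn1 -{1}[n]muln1 -{1}[n]addn0.
  by have := @step 0%N n 0%N (digit n 0) isT (digit_lt2 _ _); rewrite expn0 distnC distn0.
by have := telescope n; rewrite Cn subr0.
Qed.

(** All the conditional expectations of [|g|] have the same integral, so their coefficients add up
    to the variation. *)
Lemma L1_fourier_sum g n : integ g ->
  \int[mu]_x `|fourier_sum g n x| <= (binary_variation n)%:R * \int[mu]_x `|g x|.
Proof.
move=> intg; have intgn := integrable_normr intg.
have intE k c : integ (fun x => c * condexp mu (fun y => `|g y|) k x).
  by apply: integrableZl_EFin; exact: integrable_condexp.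
have intS : integ (fun x => \sum_(0 <= k < n)
   `|digit n k.+1 - digit n k|%N%:R * condexp mu (fun y => `|g y|) k.+1 x).
  exact: integrable_sum_nat.
apply: (@le_trans _ _ (\int[mu]_x ((digit n 0)%:R * condexp mu (fun y => `|g y|) 0 x +
  \sum_(0 <= k < n) `|digit n k.+1 - digit n k|%N%:R *
                    condexp mu (fun y => `|g y|) k.+1 x))).
  apply: le_Rintegral => //.
  - apply: integrable_normr; apply: integrable_sum_nat => k.
    by apply: integrableZl_EFin; exact: integrable_walsh.
  - exact: integrableD_EFin.
  - by move=> x _; exact: fourier_sum_variation.
rewrite RintegralD// Rintegral_sum_nat//.
have intE1 k c : \int[mu]_x (c * condexp mu (fun y => `|g y|) k x) =
    c * \int[mu]_x `|g x|.
  rewrite RintegralZl; first by rewrite Rintegral_condexpT.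
    by [].
  exact: integrable_condexp.
rewrite intE1; under eq_bigr do rewrite intE1.
rewrite -big_distrl/= -mulrDl /binary_variation big_add1/= natrD natr_sum.
by [].
Qed.

End fourier.

(** * Martingales in H1 *)

(** Holds because [top_digit] coincides with the truncated binary logarithm. *)
Lemma top_digit_bounds n : (0 < n)%N ->
  (2 ^ top_digit n <= n < 2 ^ (top_digit n).+1)%N.
Proof.
move=> n0; have /andP[ln nl] := trunc_log_bounds (isT : 1 < 2)%N n0.
suff -> : top_digit n = trunc_log 2 n by rewrite ln.
set l := trunc_log 2 n in ln nl *.
have l_n : (l < n)%N by apply: leq_trans (ltn_expl l _) ln.
apply/eqP; rewrite eqn_leq; apply/andP; split.
  apply/bigmax_leqP => j; apply: contraNleq => lj.
  by rewrite (digit_small_le nl lj).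
apply: (@leq_bigmax_cond _ _ (fun j : 'I_n => val j) (Ordinal l_n)) => /=.
by rewrite digitE modn_small// ln.
Qed.

Section martingale.
Context {R : realType} (mu : probability dyadic R).
Hypothesis mu_haar : is_haar mu.
Implicit Types (f g : dyadic -> R) (F : nat -> dyadic -> R).
Local Notation integ f := (mu.-integrable setT (EFin \o f)).

Lemma EFin_Rintegral f : integ f ->
  (\int[mu]_x f x)%:E = (\int[mu]_x (f x)%:E)%E.
Proof. by move=> intf; rewrite /Rintegral fineK//; exact: integrable_fin_num. Qed.

Lemma condexp0 n : condexp mu (fun=> 0) n = fun=> 0 :> R.
Proof. by apply: (condexp_id mu_haar). Qed.

Lemma condexpZl c n f : integ f ->
  condexp mu (fun x => c * f x) n = fun x => c * condexp mu f n x.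
Proof. by move=> intf; rewrite (@condexp_pull _ _ mu_haar n f (fun=> c)). Qed.

Lemma condexp_sum_nat N n (h : nat -> dyadic -> R) : (forall i, integ (h i)) ->
  condexp mu (fun x => \sum_(0 <= i < N) h i x) n =
  fun x => \sum_(0 <= i < N) condexp mu (h i) n x.
Proof.
move=> inth; elim: N => [|N IH].
  under eq_fun do rewrite big_geq//.
  by rewrite condexp0; apply/funext => x; rewrite big_geq.
under eq_fun do rewrite big_nat_recr//=.
rewrite condexpD//; last exact: integrable_sum_nat.
by rewrite IH; apply/funext => x; rewrite big_nat_recr.
Qed.

Lemma cyl_fun_fourier_sum g m n : (m <= 2 ^ n)%N ->
  cyl_fun n (fourier_sum mu g m).
Proof.
move=> mn x y xy; apply: eq_big_nat => k /andP[_ km].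
by rewrite (walsh_cyl _ xy)//; exact: leq_trans km mn.
Qed.

Lemma integrable_fourier_sum g m : integ (fourier_sum mu g m).
Proof.
apply: (@integrable_cyl_fun _ _ m); apply: cyl_fun_fourier_sum.
exact/ltnW/ltn_expl.
Qed.

(** Level [j] annihilates the frequencies from [2 ^ j] on and fixes the remaining sum, which is
    [condexp mu g j]. *)
Lemma condexp_fourier_sum g m j : (2 ^ j <= m)%N -> integ g ->
  condexp mu (fourier_sum mu g m) j = condexp mu g j.
Proof.
move=> jm intg.
have -> : fourier_sum mu g m = fun x => fourier_sum mu g (2 ^ j) x +
   \sum_(0 <= i < m - 2 ^ j) fourier mu g (i + 2 ^ j) * walsh (i + 2 ^ j) x.
  apply/funext => x; rewrite /fourier_sum (big_cat_nat (n := (2 ^ j)%N))//=.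
  by congr +%R; rewrite -{1}[(2 ^ j)%N]add0n big_addn.
have intw i : integ (fun x => fourier mu g (i + 2 ^ j) * walsh (i + 2 ^ j) x).
  by apply: integrableZl_EFin; exact: integrable_walsh.
rewrite condexpD//; [|exact: integrable_fourier_sum|exact: integrable_sum_nat].
rewrite (condexp_id mu_haar (cyl_fun_fourier_sum g (leqnn _))).
rewrite condexp_sum_nat//; apply/funext => x.
rewrite (fourier_sum_pow2 mu_haar)// big1 ?addr0// => i _.
rewrite condexpZl; last exact: integrable_walsh.
by rewrite (condexp_walsh mu_haar) ?leq_addl// mulr0.
Qed.

Lemma fourier_sum_id n m g x : cyl_fun n g -> (2 ^ n <= m)%N ->
  fourier_sum mu g m x = g x.
Proof.
move=> gn nm; have intg := integrable_cyl_fun mu gn.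
rewrite /fourier_sum (big_cat_nat (n := (2 ^ n)%N))//=.
rewrite [X in _ + X]big1_seq ?addr0; last first.
  move=> i; rewrite mem_index_iota => /andP[_ /andP[ni _]].
  by rewrite (fourier_ge_eq0 mu_haar gn ni) mul0r.
by have := fourier_sum_pow2 mu_haar n x intg; rewrite (condexp_id mu_haar gn).
Qed.

Lemma martingale_cyl_fun F n : martingale mu F -> cyl_fun n (F n).
Proof. by move=> /(_ n); exact: is_condexp_cyl_fun. Qed.

Lemma martingale_integrable F n : martingale mu F -> integ (F n).
Proof. by move=> MF; apply: integrable_cyl_fun; exact: martingale_cyl_fun MF. Qed.

Lemma martingale_condexp F m n : martingale mu F -> (m <= n)%N ->
  condexp mu (F n) m = F m.
Proof.
move=> MF; elim: n => [|n IH]; rewrite leq_eqVlt.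
  by rewrite orbF => /eqP ->; rewrite (condexp_id mu_haar (martingale_cyl_fun _)).
move=> /predU1P[->|].
  by rewrite (condexp_id mu_haar (martingale_cyl_fun MF)).
rewrite ltnS => mn; rewrite -(condexp_tower mu_haar mn (martingale_integrable _ MF)).
by rewrite -(condexp_unique mu_haar (MF n)) IH.
Qed.

(** The sequence whose limit defines the coefficient is constant from index [n] on. *)
Lemma walsh_coefE F n k : martingale mu F -> (k < 2 ^ n)%N ->
  walsh_coef mu F k = fourier mu (F n) k.
Proof.
move=> MF kn; apply/cvg_lim => //; apply: cvg_near_cst.
near=> m; have nm : (n <= m)%N by near: m; exact: nbhs_infty_ge.
rewrite -(martingale_condexp MF nm) fourier_condexp//.
exact: martingale_integrable.
Unshelve. all: end_near. Qed.

Lemma partial_sumE F n m : martingale mu F -> (m <= 2 ^ n)%N ->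
  partial_sum mu m F = fourier_sum mu (F n) m.
Proof.
move=> MF mn; apply/funext => x; apply: eq_big_nat => k /andP[_ km].
by rewrite (@walsh_coefE _ n)//; exact: leq_trans km mn.
Qed.

Lemma partial_sum_pow2 F n : martingale mu F -> partial_sum mu (2 ^ n) F = F n.
Proof.
move=> MF; rewrite (@partial_sumE _ n)//; apply/funext => x.
by rewrite (@fourier_sum_id n) //; exact: martingale_cyl_fun.
Qed.

Lemma condexp_partial_sum_le F m j : martingale mu F -> (2 ^ j <= m)%N ->
  condexp mu (partial_sum mu m F) j = F j.
Proof.
move=> MF jm; have mm : (m <= 2 ^ m)%N by exact/ltnW/ltn_expl.
have jm' : (j <= m)%N.
  by rewrite (leq_trans _ jm)//; exact/ltnW/ltn_expl.
rewrite (partial_sumE MF mm) condexp_fourier_sum//; last exact: martingale_integrable.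
exact: martingale_condexp.
Qed.

Lemma condexp_partial_sum_ge F m j : martingale mu F -> (m <= 2 ^ j)%N ->
  condexp mu (partial_sum mu m F) j = partial_sum mu m F.
Proof.
move=> MF mj; rewrite (partial_sumE MF mj) (condexp_id mu_haar)//.
exact: cyl_fun_fourier_sum.
Qed.

(** * The maximal function and part (a) *)

Lemma le_maximal_fun F n x : (`|F n x|%:E <= maximal_fun F x)%E.
Proof. by apply: ereal_sup_ubound; exists n. Qed.

Lemma maximal_fun_le F x y : (forall n, (`|F n x|%:E <= y)%E) ->
  (maximal_fun F x <= y)%E.
Proof. by move=> Fy; apply: ge_ereal_sup => _ [n _ <-]. Qed.

Lemma maximal_fun_ge0 F x : (0 <= maximal_fun F x)%E.
Proof. by apply: le_trans (le_maximal_fun F 0 x). Qed.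

Lemma measurable_maximal_fun F : (forall n, cyl_fun n (F n)) ->
  measurable_fun setT (maximal_fun F).
Proof.
move=> Fn.
have -> : maximal_fun F = fun x => esups (fun n => `|F n x|%:E) 0%N.
  apply/funext => x; rewrite /maximal_fun /esups /=; congr ereal_sup.
  by apply/seteqP; split=> _ [n _ <-]; exists n.
apply: measurable_fun_esups => n.
apply/measurable_EFinP; apply: measurableT_comp => //.
exact: cyl_fun_measurable (Fn n).
Qed.

Lemma L1_le_H1norm F n : (forall n, cyl_fun n (F n)) ->
  ((\int[mu]_x `|F n x|)%:E <= H1norm mu F)%E.
Proof.
move=> Fcyl; have Fn := Fcyl n; have intF := integrable_cyl_fun mu Fn.
rewrite /H1norm EFin_Rintegral; last exact: integrable_normr.
apply: ge0_le_integral => //.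
- by apply/measurable_EFinP; apply: measurableT_comp => //; exact: cyl_fun_measurable Fn.
- exact: measurable_maximal_fun.
- by move=> x _; exact: le_maximal_fun.
Qed.

Lemma omega_H1_cyl_fun F N n : martingale mu F ->
  cyl_fun n (fun x => F n x - condexp mu (partial_sum mu (2 ^ N) F) n x).
Proof.
move=> MF => x y xy; rewrite (martingale_cyl_fun MF xy).
by rewrite (cyl_fun_condexp _ _ xy).
Qed.

(* With [N = |m|], [S_m F - F_N = S_m (F_(N+1) - F_N)], while [S_m F] has the same
   conditional expectations as [F] up to level [N] and is fixed by the later ones. *)
Lemma H1dist_le F m : martingale mu F -> (0 < m)%N ->
  (H1dist mu m F <=
   ((binary_variation m)%:R + 1)%:E * omega_H1 mu (top_digit m) F)%E.
Proof.
move=> MF m0; have /andP[Nm mN] := top_digit_bounds m0.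
set N := top_digit m in Nm mN *.
have FN := martingale_cyl_fun (n := _) MF.
have intF n := martingale_integrable n MF.
pose G x := F N.+1 x - F N x.
have intG : integ G by exact: integrableB_EFin.
pose P := fourier_sum mu G m.
have PE x : P x = partial_sum mu m F x - F N x.
  rewrite /P /G fourier_sumB// (partial_sumE MF (ltnW mN)).
  by rewrite [X in _ - X](@fourier_sum_id N)//; exact: FN.
pose O j x := F j x - condexp mu (partial_sum mu (2 ^ N) F) j x.
have OE x j : (N <= j)%N -> O j x = F j x - F N x.
  move=> Nj; rewrite /O partial_sum_pow2// (condexp_id mu_haar (n := j))//.
  by apply: (@cyl_funS _ N) => //; exact: FN.
have O_cyl n : cyl_fun n (O n) by exact: omega_H1_cyl_fun.
(* For [j <= N] the left side vanishes; for [j > N] it is the modulus of [P x - O j x]. *)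
have PO x j : `|condexp mu (partial_sum mu m F) j x - F j x| <= `|P x| + `|O j x|.
  have [jN|Nj] := leqP j N.
    rewrite condexp_partial_sum_le// ?subrr ?normr0//.
    by rewrite (leq_trans _ Nm)// leq_pexp2l.
  rewrite condexp_partial_sum_ge//; last first.
    by rewrite (leq_trans (ltnW mN))// leq_pexp2l.
  rewrite PE OE ?(ltnW Nj)// -normrN.
  have -> : - (partial_sum mu m F x - F j x) =
     (F j x - F N x) - (partial_sum mu m F x - F N x) by ring.
  by rewrite addrC -[X in _ <= X + _]normrN; exact: ler_normD.
have mP : measurable_fun setT P.
  apply: (@cyl_fun_measurable _ N.+1).
  by apply: cyl_fun_fourier_sum; exact: ltnW.
have leint : (H1dist mu m F <= (\int[mu]_x `|P x|)%:E + omega_H1 mu N F)%E.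
  rewrite EFin_Rintegral; last by apply: integrable_normr; exact: integrable_fourier_sum.
  have mPE : measurable_fun setT (fun x => `|P x|%:E).
    by apply/measurable_EFinP; apply: measurableT_comp.
  have mO : measurable_fun setT (maximal_fun O) by exact: measurable_maximal_fun.
  rewrite -ge0_integralD//; last by move=> x _; exact: maximal_fun_ge0.
  apply: ge0_le_integral => //.
  - by move=> x _; exact: maximal_fun_ge0.
  - apply: measurable_maximal_fun => n x y xy.
    by rewrite (martingale_cyl_fun MF xy) (cyl_fun_condexp _ _ xy).
  - exact: emeasurable_funD.
  - move=> x _; apply: maximal_fun_le => n.
    apply: (@le_trans _ _ (`|P x| + `|O n x|)%:E); first by rewrite lee_fin.
    by rewrite EFinD leeD2l//; exact: le_maximal_fun.
apply: (le_trans leint).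
(* The summand 1 of the constant accounts for [O], and the variation for the norm of [P]. *)
rewrite EFinD ge0_muleDl ?lee_fin// mul1e leeD2r//.
have := L1_fourier_sum mu_haar m intG; rewrite -/P -lee_fin => /le_trans; apply.
rewrite EFinM; apply: lee_pmul => //; rewrite ?lee_fin//.
  by apply: Rintegral_ge0.
(* [O N.+1] is [G], whose [L1] norm is thus at most the modulus of continuity. *)
have := L1_le_H1norm N.+1 O_cyl.
by under eq_Rintegral do rewrite OE//.
Qed.

(** With zero variation the digits start at 0 and never change, against the leading digit 1. *)
Lemma binary_variation_gt0 m : (0 < m)%N -> (0 < binary_variation m)%N.
Proof.
move=> m0; rewrite lt0n; apply/negP => /eqP V0.
have dig j : (j <= m)%N -> digit m j = 0%N.
  elim: j => [_|j IH jm]; first by move: V0; rewrite /binary_variation; lia.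
  move: V0; rewrite /binary_variation (bigD1_seq j.+1) ?iota_uniq//=; last first.
    by rewrite mem_index_iota.
  by move=> V0; have := IH (ltnW jm); lia.
have /andP[Nm mN] := top_digit_bounds m0.
have := dig (top_digit m); rewrite digitE modn_small// Nm.
suff -> : (top_digit m <= m)%N by move=> /(_ isT).
by rewrite (leq_trans _ Nm)//; exact/ltnW/ltn_expl.
Qed.

Lemma H1_convergence F (m : nat -> nat) : martingale mu F ->
  (forall k, (0 < m k)%N) ->
  elittleo (fun k => omega_H1 mu (top_digit (m k)) F)
           (fun k => (binary_variation (m k))%:R^-1 : R) ->
  H1dist mu (m k) F @[k --> \oo] --> 0%E.
Proof.
move=> MF m0 om.
have H0 k : (0 <= H1dist mu (m k) F)%E.
  by apply: integral_ge0 => x _; exact: maximal_fun_ge0.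
have small eps : 0 < eps -> \forall k \near \oo, (H1dist mu (m k) F <= eps%:E)%E.
  (* Half of [eps] suffices, as [(v + 1) / v <= 2] for a variation [v >= 1]. *)
  move=> e0; have e20 : 0 < eps / 2 by rewrite divr_gt0.
  apply: filterS (om _ e20) => k omk.
  apply: (le_trans (H1dist_le MF (m0 k))).
  set v := binary_variation (m k) in omk *.
  have v1 : 1 <= v%:R :> R by rewrite ler1n binary_variation_gt0.
  apply: (@le_trans _ _ ((v%:R + 1)%:E * (eps / 2 * `|v%:R^-1|)%:E)%E).
    apply: lee_wpmul2l; first by rewrite lee_fin addr_ge0.
    by apply: le_trans omk; exact: lee_abs.
  rewrite -EFinM lee_fin ger0_norm ?invr_ge0//.
  have vV : v%:R * v%:R^-1 = 1 :> R by rewrite divff// gt_eqF// (lt_le_trans ltr01).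
  have vi1 : v%:R^-1 <= 1 :> R by rewrite invf_le1// (lt_le_trans ltr01).
  rewrite mulrDl mul1r mulrCA vV mulr1 [leRHS](splitr eps) lerD2l.
  by rewrite -[leRHS]mulr1 ler_wpM2l// ltW.
apply/fine_cvgP; split.
  apply: filterS (small 1 ltr01) => k Hk.
  by rewrite ge0_fin_numE//; exact: le_lt_trans Hk (ltry _).
apply/cvgrPdist_le => e e0; apply: filterS (small e e0) => k Hk.
have Hfin : H1dist mu (m k) F \is a fin_num.
  by rewrite ge0_fin_numE//; exact: le_lt_trans Hk (ltry _).
by rewrite sub0r normrN /= ger0_norm ?fine_ge0// -lee_fin fineK.
Qed.

End martingale.

(** * Lower bound for the Dirichlet kernel *)

(** On these pairwise disjoint sets the Walsh functions of index below [2 ^ s.+1] are explicit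
    signs, so the Dirichlet kernel can be evaluated exactly. *)
Definition first_one (s : nat) (x : dyadic) : Prop :=
  (forall k, (k < s)%N -> x k = false) /\ x s.

Lemma first_one_inj s t x : first_one s x -> first_one t x -> s = t.
Proof.
move=> [xs0 xs] [xt0 xt]; case: (ltngtP s t) => // [/xt0|/xs0].
  by rewrite xs.
by rewrite xt.
Qed.

Lemma first_oneE s : first_one s = cyl s.+1 (fun k => k == s).
Proof.
apply/seteqP; split => x.
  move=> [x0 xs]; apply/cylS; rewrite eqxx; split => // k ks.
  by rewrite x0// ltn_eqF.
move=> /cylS[x0 xs]; rewrite eqxx in xs; split => // k ks.
by rewrite x0// ltn_eqF.
Qed.

Lemma cyl_fun_indic (R : realType) n z : cyl_fun n (\1_(cyl n z) : dyadic -> R).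
Proof.
move=> x y xy; rewrite !indicE; suff -> : (x \in cyl n z) = (y \in cyl n z) by [].
by apply/idP/idP; rewrite !inE => zx k kn; rewrite -zx// xy.
Qed.

Section dirichlet.
Context {R : realType}.

Definition dirichlet (n : nat) (x : dyadic) : R := \sum_(0 <= k < n) walsh k x.

Lemma walsh_first_one s x i : first_one s x -> (i < 2 ^ s.+1)%N ->
  walsh i x = (-1) ^+ (2 ^ s <= i)%N :> R.
Proof.
move=> [x0 xs] i_s; rewrite (walsh_widen _ i_s) big_ord_recr/= big1 ?mul1r.
  by rewrite /rademacher xs expr1 digitE modn_small.
by move=> j _; rewrite /rademacher x0// expr0 expr1n.
Qed.

Lemma dirichlet_first_one_le s x r : first_one s x -> (r <= 2 ^ s)%N ->
  dirichlet r x = r%:R.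
Proof.
move=> xs rs; rewrite /dirichlet (eq_big_nat _ _ (F2 := fun=> 1)).
  by rewrite sumr_const_nat subn0.
move=> i /andP[_ ir]; have i_s : (i < 2 ^ s)%N by exact: leq_trans rs.
have si : (2 ^ s <= i)%N = false by apply/negbTE; rewrite -ltnNge.
rewrite (walsh_first_one xs) ?si//.
by rewrite (ltn_trans i_s)// ltn_exp2l.
Qed.

(** The first [2 ^ s] terms are 1 and the next [2 ^ s] are -1: the kernel climbs to [2 ^ s] and
    descends to 0. *)
Lemma dirichlet_first_one_ge s x t : first_one s x -> (t <= 2 ^ s)%N ->
  dirichlet (2 ^ s + t) x = (2 ^ s - t)%N%:R.
Proof.
move=> xs ts; rewrite /dirichlet (big_cat_nat (n := (2 ^ s)%N)) ?leq_addr//=.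
have := dirichlet_first_one_le xs (leqnn _); rewrite /dirichlet => ->.
rewrite -[X in index_iota X _]add0n big_addn addKn natrB//; congr +%R.
rewrite (eq_big_nat _ _ (F2 := fun=> - 1)).
  by rewrite sumr_const_nat subn0 mulNrn.
move=> i /andP[_ it]; have i_s : (i < 2 ^ s)%N by exact: leq_trans ts.
rewrite (walsh_first_one xs) ?leq_addl ?expr1//.
by rewrite expnS mul2n -addnn ltn_add2r.
Qed.

(** Each full block of [2 ^ s.+1] frequencies sums to 0, so only the incomplete one remains. *)
Lemma dirichlet_block s x q r : first_one s x -> (r <= 2 ^ s.+1)%N ->
  dirichlet (q * 2 ^ s.+1 + r) x = walsh (q * 2 ^ s.+1) x * dirichlet r x.
Proof.
move=> xs; have split p t : (t <= 2 ^ s.+1)%N ->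
    dirichlet (p * 2 ^ s.+1 + t) x =
    dirichlet (p * 2 ^ s.+1) x + walsh (p * 2 ^ s.+1) x * dirichlet t x.
  move=> ts; rewrite /dirichlet (big_cat_nat (n := (p * 2 ^ s.+1)%N)) ?leq_addr//=.
  congr +%R; rewrite -{1}[(p * 2 ^ s.+1)%N]add0n big_addn addKn big_distrr/=.
  apply: eq_big_nat => i /andP[_ it].
  by rewrite addnC walsh_block//; exact: leq_trans ts.
suff q0 : dirichlet (q * 2 ^ s.+1) x = 0 by move=> /split ->; rewrite q0 add0r.
elim: q => [|q IH]; first by rewrite mul0n /dirichlet big_geq.
rewrite mulSn addnC split// IH add0r.
have := dirichlet_first_one_ge xs (leqnn _).
by rewrite addnn -mul2n -expnS subnn => ->; rewrite mulr0.
Qed.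

(** Only the residue [r] of [n] modulo [2 ^ j.+2] matters. Its two leading digits are 01 or 10, so
    [r] lies in the middle half of the period, where the tent-shaped kernel has height at least
    [2 ^ j]. *)
Lemma dirichlet_lower n j x : first_one j.+1 x -> digit n j.+1 != digit n j ->
  2 ^+ j <= `|dirichlet n x|.
Proof.
move=> xj dj; set r := (n %% 2 ^ j.+2)%N.
have rlt : (r < 2 ^ j.+2)%N by rewrite ltn_pmod// expn_gt0.
rewrite [n](divn_eq n (2 ^ j.+2)) dirichlet_block// -/r; last exact: ltnW.
rewrite normrM normr_walsh mul1r.
have rE : r = (digit n j.+1 * 2 ^ j.+1 + (digit n j * 2 ^ j + n %% 2 ^ j))%N.
  by rewrite /r !mod_pow2_step.
have nlt : (n %% 2 ^ j < 2 ^ j)%N by rewrite ltn_pmod// expn_gt0.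
rewrite -natrX; have e2 : (2 ^ j.+1 = 2 ^ j + 2 ^ j)%N by rewrite expnS mul2n addnn.
move: dj rE; case: (digit n j.+1) (digit_lt2 n j.+1) => [|[]]// _;
  case: (digit n j) (digit_lt2 n j) => [|[]]// _ _.
  rewrite mul0n add0n mul1n => rE.
  rewrite (dirichlet_first_one_le xj); last by rewrite e2 rE leq_add2l ltnW.
  by rewrite normr_nat ler_nat rE leq_addr.
rewrite mul1n mul0n add0n => rE; rewrite rE (dirichlet_first_one_ge xj).
  by rewrite normr_nat ler_nat e2; lia.
by rewrite e2; lia.
Qed.

Lemma sum_walsh_lower n N j x : (2 ^ N <= n < 2 ^ N.+1)%N -> (j < N)%N ->
  first_one j.+1 x -> digit n j.+1 != digit n j ->
  2 ^+ j <= `|\sum_(n <= k < 2 ^ N.+1) walsh k x| :> R.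
Proof.
move=> /andP[Nn nN] jN xj dj.
(* Since [j < N], the order [2 ^ N.+1] is a multiple of the period [2 ^ j.+2]; the sum is therefore
   [- dirichlet n x]. *)
have D0 : dirichlet (2 ^ N.+1) x = 0.
  have -> : (2 ^ N.+1 = 2 ^ (N - j.+1) * 2 ^ j.+2 + 0)%N.
    by rewrite addn0 -expnD addnS subnK.
  by rewrite dirichlet_block// /dirichlet big_geq// mulr0.
have := dirichlet_lower xj dj.
suff -> : \sum_(n <= k < 2 ^ N.+1) walsh k x = - dirichlet n x by rewrite normrN.
apply/eqP; rewrite -addr_eq0 addrC; apply/eqP; rewrite -[RHS]D0.
by rewrite /dirichlet -big_cat_nat ?(ltnW nN).
Qed.

(** The 2 covers the initial digit and the final drop from digit [N] to digit [N.+1]. *)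
Lemma binary_variation_le n N : (2 ^ N <= n < 2 ^ N.+1)%N ->
  (binary_variation n <= 2 + \sum_(0 <= j < N) `|digit n j.+1 - digit n j|)%N.
Proof.
move=> /andP[Nn nN]; rewrite /binary_variation big_add1/=.
have Nltn : (N < n)%N by apply: leq_trans Nn; exact: ltn_expl.
rewrite (big_cat_nat (n := N)) ?(ltnW Nltn)//=.
rewrite (big_ltn Nltn) [X in (_ + (_ + (_ + X)))%N]big1_seq; last first.
  move=> j; rewrite mem_index_iota => /andP[_ /andP[Nj _]].
  by rewrite (digit_small_le nN (leqW Nj)) (digit_small_le nN Nj).
have := digit_lt2 n 0; have := digit_lt2 n N.
rewrite (digit_small nN); lia.
Qed.

Context (mu : probability dyadic R).
Hypothesis mu_haar : is_haar mu.

Lemma Rintegral_cyl n z : \int[mu]_x \1_(cyl n z) x = 2^-1 ^+ n :> R.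
Proof.
rewrite /Rintegral integral_indic ?setIT//; last exact: measurable_cyl.
by transitivity (fine (mu (cyl n z))) => //; rewrite mu_haar.
Qed.

Lemma L1_sum_walsh n N : (2 ^ N <= n < 2 ^ N.+1)%N ->
  ((binary_variation n)%:R - 2) / 4 <=
  \int[mu]_x `|\sum_(n <= k < 2 ^ N.+1) walsh k x|.
Proof.
move=> nN; pose e j : R := `|digit n j.+1 - digit n j|%N%:R.
(* The lower bounds of the overview, carried by disjoint cylinders of measure [2^-(j+2)]: each jump
   contributes 1/4 to the integral. *)
pose h j x : R := e j * 2 ^+ j * \1_(cyl j.+2 (fun k => k == j.+1)) x.
have h_cyl j : cyl_fun j.+2 (h j).
  by move=> x y xy; rewrite /h (@cyl_fun_indic R _ _ x y xy).
have inth j : mu.-integrable setT (EFin \o h j).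
  exact: integrable_cyl_fun (h_cyl j).
have int_h j : \int[mu]_x h j x = e j / 4.
  rewrite RintegralZl//; last first.
    exact: (@integrable_cyl_fun _ mu j.+2 _ (@cyl_fun_indic R _ _)).
  rewrite Rintegral_cyl -mulrA; congr *%R.
  rewrite !exprS mulrCA mulrA -mulrA [X in _ * X]mulrC.
  rewrite -[X in _ * X]mulrA -exprMn mulVf// expr1n mulr1 -invfM.
  by congr (_^-1); ring.
apply: (@le_trans _ _ (\int[mu]_x \sum_(0 <= j < N) h j x)).
  rewrite Rintegral_sum_nat//; under eq_bigr do rewrite int_h.
  rewrite -big_distrl/= ler_pM2r ?invr_gt0// lerBlDl.
  by rewrite -natr_sum -natrD ler_nat binary_variation_le.
apply: le_Rintegral => //.
- exact: integrable_sum_nat.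
- apply: integrable_normr; apply: (@integrable_cyl_fun _ _ N.+1) => x y xy.
  by apply: eq_big_nat => k /andP[_ kN]; exact: walsh_cyl xy.
- move=> x _.
  have hE j : h j x = e j * 2 ^+ j * (`[< first_one j.+1 x >])%:R.
    by rewrite /h indicE first_oneE.
  (* At a given point at most one [h j] is nonzero. *)
  have [[j jN xj]|nx] := pselect (exists2 j, (j < N)%N & first_one j.+1 x).
    rewrite (bigD1_seq j) ?iota_uniq ?mem_index_iota//= big1 ?addr0; last first.
      move=> i ij; rewrite hE asboolF ?mulr0// => xi.
      by move/eqP: ij; apply; have [] := first_one_inj xi xj.
    rewrite hE asboolT// mulr1 /e.
    have [->|dj] := eqVneq (digit n j.+1) (digit n j); first by rewrite distnn mul0r.
    apply: le_trans (sum_walsh_lower nN jN xj dj).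
    rewrite ler_piMl ?exprn_ge0// (_ : 1 = 1%:R)// ler_nat.
    by have := digit_lt2 n j.+1; have := digit_lt2 n j; lia.
  rewrite big1_seq// => j; rewrite mem_index_iota => /andP[_ /andP[_ jN]].
  by rewrite hE asboolF ?mulr0// => xj; apply: nx; exists j.
Qed.

End dirichlet.

(** * A lacunary martingale *)

Section lacunary.
Context {R : realType} (mu : probability dyadic R).
Hypothesis mu_haar : is_haar mu.
Variables (N : nat -> nat) (lam : nat -> R).
Hypothesis N_incr : {homo N : i j / (i < j)%N}.
Hypothesis lam_ge0 : forall k, 0 <= lam k.
Hypothesis lam_half : forall k, lam k.+1 <= lam k / 2.
Local Notation integ f := (mu.-integrable setT (EFin \o f)).

(** The Dirichlet kernel of order [2 ^ n]; then [bump n] is the difference of those of orders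
    [2 ^ n.+1] and [2 ^ n]. *)
Definition peak (n : nat) (x : dyadic) : R := 2 ^+ n * \1_(cyl n (fun=> false)) x.

Definition bump (n : nat) (x : dyadic) : R := peak n x * rademacher n x.

(** Conditional expectations of a formal infinite series. Stopping at [k < n] loses nothing:
    [N k >= k], so later bumps average to 0 at level [n]. *)
Definition lacunary (n : nat) (x : dyadic) : R :=
  \sum_(0 <= k < n) lam k * condexp mu (bump (N k)) n x.

Lemma peak_ge0 n x : 0 <= peak n x.
Proof. by rewrite mulr_ge0 ?exprn_ge0// indicE. Qed.

Lemma cyl_fun_peak n : cyl_fun n (peak n).
Proof. by move=> x y xy; rewrite /peak (@cyl_fun_indic R _ _ x y xy). Qed.

Lemma Rintegral_peak n : \int[mu]_x peak n x = 1.
Proof.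
rewrite RintegralZl//.
  by rewrite (Rintegral_cyl mu_haar) -exprMn divff// expr1n.
exact: (@integrable_cyl_fun _ mu n _ (@cyl_fun_indic R _ _)).
Qed.

Lemma cyl_fun_rademacher n : cyl_fun n.+1 (@rademacher R n).
Proof. by move=> x y /cylS[_ xy]; rewrite /rademacher xy. Qed.

Lemma cyl_fun_bump n : cyl_fun n.+1 (bump n).
Proof.
move=> x y xy; rewrite /bump (@cyl_fun_rademacher _ x y xy).
by rewrite (@cyl_fun_peak n x y)//; exact: cyl_le xy.
Qed.

Lemma integrable_bump n : integ (bump n).
Proof. exact: integrable_cyl_fun (@cyl_fun_bump n). Qed.

Lemma condexp_bump j n :
  condexp mu (bump n) j = if (j <= n)%N then fun=> 0 else bump n.
Proof.
case: leqP => jn.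
  rewrite -(condexp_tower mu_haar jn (integrable_bump n)).
  rewrite (condexp_pull mu_haar (@cyl_fun_peak n)); last first.
    exact: integrable_cyl_fun (@cyl_fun_rademacher n).
  have -> : (fun x => peak n x * condexp mu (rademacher n) n x) = fun=> 0.
    by apply/funext => x; rewrite condexp_rademacher// mulr0.
  exact: condexp0.
by rewrite (condexp_id mu_haar)//; exact: (cyl_funS jn (@cyl_fun_bump n)).
Qed.

Lemma normr_condexp_bump j n x : `|condexp mu (bump n) j x| <= peak n x.
Proof.
rewrite condexp_bump; case: ifP => _; first by rewrite normr0 peak_ge0.
rewrite normrM ger0_norm ?peak_ge0// /rademacher.
by rewrite normrX normrN1 expr1n mulr1.
Qed.

Lemma leq_N k : (k <= N k)%N.
Proof. by elim: k => // k IH; exact: leq_ltn_trans (N_incr (ltnSn k)). Qed.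

Lemma N_mono i j : (i <= j)%N -> (N i <= N j)%N.
Proof. by rewrite leq_eqVlt => /predU1P[->//|/N_incr/ltnW]. Qed.

Lemma lacunary_widen M n x : (n <= M)%N ->
  lacunary n x = \sum_(0 <= k < M) lam k * condexp mu (bump (N k)) n x.
Proof.
move=> nM; rewrite [RHS](big_cat_nat (n := n))//= [X in _ + X]big1_seq ?addr0//.
move=> k; rewrite mem_index_iota => /andP[_ /andP[nk _]].
by rewrite condexp_bump (leq_trans nk (leq_N k)) mulr0.
Qed.

Lemma cyl_fun_lacunary n : cyl_fun n (lacunary n).
Proof.
move=> x y xy; apply: eq_bigr => k _.
by rewrite (@cyl_fun_condexp _ mu n _ x y xy).
Qed.

Lemma integrable_lacunary n : integ (lacunary n).
Proof. exact: integrable_cyl_fun (@cyl_fun_lacunary n). Qed.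

Lemma lacunary_martingale : martingale mu lacunary.
Proof.
move=> n; suff <- : condexp mu (lacunary n.+1) n = lacunary n.
  by apply: condexpP => //; exact: integrable_lacunary.
have intc k : integ (condexp mu (bump (N k)) n.+1).
  by apply: integrable_condexp; exact: integrable_bump.
rewrite (condexp_sum_nat mu_haar); last by move=> k; exact: integrableZl_EFin.
apply/funext => x; rewrite (@lacunary_widen n.+1)//; apply: eq_bigr => k _.
rewrite (condexpZl mu_haar)// (condexp_tower mu_haar)//.
exact: integrable_bump.
Qed.

(** One bound for all increments after level [N i]; it controls the [H1] norm and the modulus of
    continuity, and serves as dominating function. *)
Definition majorant (i : nat) (x : dyadic) : \bar R :=
  (\sum_(0 <= k <oo) (lam (i + k) * peak (N (i + k)) x)%:E)%E.

Lemma majorant_term_ge0 i k x : (0 <= (lam (i + k) * peak (N (i + k)) x)%:E)%E.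
Proof. by rewrite lee_fin mulr_ge0// peak_ge0. Qed.

Lemma lam_sum_le i n : \sum_(0 <= k < n) lam (i + k) <= 2 * lam i.
Proof.
(* The extra term makes the induction pass: [lam (i + n) + 2 * lam (i + n).+1] is at most
   [2 * lam (i + n)]. *)
suff : \sum_(0 <= k < n) lam (i + k) + 2 * lam (i + n) <= 2 * lam i.
  by apply: le_trans; rewrite lerDl mulr_ge0.
elim: n => [|n IH]; first by rewrite big_geq// add0r addn0.
apply: le_trans IH; rewrite big_nat_recr//= -addrA lerD2l addnS.
have := lam_half (i + n); lra.
Qed.

Lemma measurable_peak n c : measurable_fun setT (fun x => (c * peak n x)%:E).
Proof.
apply/measurable_EFinP; apply: measurable_funM => //.
exact: cyl_fun_measurable (@cyl_fun_peak n).
Qed.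

Lemma measurable_majorant i : measurable_fun setT (majorant i).
Proof.
apply: ge0_emeasurable_sum => k *; last exact: measurable_peak.
exact: majorant_term_ge0.
Qed.

Lemma majorant_ge0 i x : (0 <= majorant i x)%E.
Proof. by apply: nneseries_ge0 => k _ _; exact: majorant_term_ge0. Qed.

Lemma integral_majorant_le i : (\int[mu]_x majorant i x <= (2 * lam i)%:E)%E.
Proof.
rewrite integral_nneseries//; last 2 first.
- by move=> k; exact: measurable_peak.
- by move=> k x _; exact: majorant_term_ge0.
have int1 k : (\int[mu]_x (lam (i + k) * peak (N (i + k)) x)%:E = (lam (i + k))%:E)%E.
  have intp : integ (peak (N (i + k))) by exact: integrable_cyl_fun (@cyl_fun_peak _).
  rewrite -EFin_Rintegral; last exact: integrableZl_EFin.
  by rewrite RintegralZl// Rintegral_peak mulr1.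
rewrite (eq_eseriesr (g := fun k => (lam (i + k))%:E))//.
apply: lime_le.
  by apply: is_cvg_nneseries => k _ _; rewrite lee_fin.
by near=> n; rewrite sumEFin lee_fin lam_sum_le.
Unshelve. all: end_near. Qed.

(** Bumps of index below [i] are complete at both levels and cancel; the others vanish at level
    [N i] and are bounded by their peaks at level [j]. *)
Lemma lacunary_diff_le i j x : (N i <= j)%N ->
  (`|lacunary j x - lacunary (N i) x|%:E <= majorant i x)%E.
Proof.
move=> ij; have i_j : (i <= j)%N by exact: leq_trans (leq_N i) ij.
apply: (@le_trans _ _ (\sum_(0 <= k < j - i) lam (i + k) * peak (N (i + k)) x)%:E).
  rewrite lee_fin (@lacunary_widen j (N i))// /lacunary -sumrB.
  rewrite (big_cat_nat (n := i))//= [X in X + _]big1_seq ?add0r; last first.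
    move=> k; rewrite mem_index_iota => /andP[_ /andP[_ ki]].
    have Nki := N_incr ki; have Nkj := leq_trans Nki ij.
    by rewrite !condexp_bump (leqNgt (N i)) (leqNgt j) Nki Nkj subrr.
  rewrite -{1}[i]add0n big_addn; apply: (le_trans (ler_norm_sum _ _ _)).
  apply: ler_sum => k _; rewrite addnC [X in _ - X](_ : _ = 0) ?subr0.
    by rewrite normrM ger0_norm// ler_wpM2l// normr_condexp_bump.
  by rewrite condexp_bump N_mono ?leq_addr// mulr0.
rewrite -sumEFin; apply: nneseries_lim_ge => k _ _; exact: majorant_term_ge0.
Qed.

Lemma lacunary_le j x : (`|lacunary j x|%:E <= majorant 0 x)%E.
Proof.
have L0 n : (n <= N 0)%N -> lacunary n x = 0.
  move=> n0; rewrite /lacunary big1// => k _.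
  by rewrite condexp_bump (leq_trans n0 (N_mono (leq0n k))) mulr0.
have [j0|j0] := leqP j (N 0); first by rewrite L0// normr0 majorant_ge0.
by have := @lacunary_diff_le 0 j x (ltnW j0); rewrite (L0 (N 0))// subr0.
Qed.

Lemma H1_lacunary : H1 mu lacunary.
Proof.
split; first exact: lacunary_martingale.
apply: (@le_lt_trans _ _ (2 * lam 0)%:E); last exact: ltry.
apply: le_trans (integral_majorant_le 0); apply: ge0_le_integral => //.
- by move=> x _; exact: maximal_fun_ge0.
- by apply: measurable_maximal_fun; exact: cyl_fun_lacunary.
- exact: measurable_majorant.
- by move=> x _; apply: maximal_fun_le => n; exact: lacunary_le.
Qed.

Lemma omega_H1_lacunary i : (omega_H1 mu (N i) lacunary <= (2 * lam i)%:E)%E.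
Proof.
have ML := lacunary_martingale.
apply: le_trans (integral_majorant_le i); apply: ge0_le_integral => //.
- by move=> x _; exact: maximal_fun_ge0.
- by apply: measurable_maximal_fun => n; exact: omega_H1_cyl_fun.
- exact: measurable_majorant.
- move=> x _; apply: maximal_fun_le => j.
  rewrite partial_sum_pow2//; have [jN|Nj] := leqP j (N i).
    by rewrite (martingale_condexp mu_haar ML jN) subrr normr0 majorant_ge0.
  rewrite (condexp_id mu_haar); first exact/lacunary_diff_le/ltnW.
  exact: (cyl_funS (ltnW Nj) (@cyl_fun_lacunary _)).
Qed.

(** * The integrable limit of the lacunary martingale *)

(** An upper limit is measurable without any convergence; the default value of [fine] can occur only
    at the zero sequence. *)
Definition lacunary_limit (x : dyadic) : R :=
  fine (limn_esup (fun n => (lacunary n x)%:E)).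

Lemma measurable_lacunary_limit : measurable_fun setT lacunary_limit.
Proof.
apply: (measurableT_comp (fine_measurable measurableT)).
apply: measurable_fun_limn_esup => n; apply/measurable_EFinP.
exact: cyl_fun_measurable (@cyl_fun_lacunary n).
Qed.

(** If [x i] holds, all peaks of level above [i] vanish at [x], so the sequence is constant from
    [N i.+1] on. *)
Lemma lacunary_cvg x : x <> (fun=> false) ->
  (lacunary n x)%:E @[n --> \oo] --> (lacunary_limit x)%:E.
Proof.
move=> x0; have [i xi] : exists i, x i.
  apply: contrapT => nx; apply: x0; apply/funext => i.
  by apply/negbTE/negP => xi; apply: nx; exists i.
have peak0 n : (i < n)%N -> peak n x = 0.
  move=> ni; rewrite /peak indicE memNset ?mulr0// => x_cyl.
  by have := x_cyl i ni; rewrite xi.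
have cst n : (N i.+1 <= n)%N -> (lacunary n x)%:E = (lacunary (N i.+1) x)%:E.
  move=> ni; congr EFin; apply/eqP; rewrite -subr_eq0 -normr_le0 -lee_fin.
  apply: (le_trans (lacunary_diff_le x ni)); rewrite /majorant eseries0// => k _ _.
  rewrite peak0 ?mulr0//; apply: leq_trans (leq_N _).
  by rewrite addSn ltnS leq_addr.
have L : (lacunary n x)%:E @[n --> \oo] --> (lacunary (N i.+1) x)%:E.
  by apply: cvg_near_cst; exists (N i.+1) => // n /= /cst.
by rewrite /lacunary_limit (cvg_limn_einf_sup L).2.
Qed.

Lemma haar_set1 x : measurable [set x] /\ mu [set x] = 0%E.
Proof.
have xE : [set x] = \bigcap_n cyl n x.
  apply/seteqP; split=> [_ -> n _//|y xy]; apply/funext => k.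
  exact: (xy k.+1 I k (ltnSn k)).
have mx : measurable [set x].
  by rewrite xE; apply: bigcapT_measurable => n; exact: measurable_cyl.
split => //; apply/eqP; rewrite eq_le measure_ge0 andbT.
have le2 n : (mu [set x] <= (2^-1 ^+ n)%:E)%E.
  rewrite -(mu_haar n x); apply: le_measure; rewrite ?inE//.
  - exact: measurable_cyl.
  - by move=> _ ->.
have fx : mu [set x] \is a fin_num by exact: fin_num_measure.
rewrite -(fineK fx) lee_fin leNgt; apply/negP => /ltr_add_invr[k].
rewrite add0r => klt; have := le2 k.+1; rewrite -(fineK fx) lee_fin.
apply/negP; rewrite -ltNge; apply: le_lt_trans klt.
rewrite exprVn lef_pV2 ?posrE ?exprn_gt0// -natrX ler_nat.
exact/ltnW/ltn_expl.
Qed.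

Lemma integrable_majorant : mu.-integrable setT (majorant 0).
Proof.
apply/integrableP; split; first exact: measurable_majorant.
under eq_integral do rewrite gee0_abs ?majorant_ge0//.
exact: le_lt_trans (integral_majorant_le 0) (ltry _).
Qed.

(** Dominated convergence with [majorant 0], the zero sequence being negligible. General sets [A]
    serve to test conditional expectations. *)
Lemma lacunary_dominated A : measurable A ->
  mu.-integrable A (EFin \o lacunary_limit) /\
  (\int[mu]_(x in A) (lacunary n x)%:E @[n --> \oo] -->
     \int[mu]_(x in A) (lacunary_limit x)%:E)%E.
Proof.
move=> mA; pose f_ n x := (lacunary n x)%:E.
have [] // := @dominated_convergence _ _ _ mu A mA f_ (EFin \o lacunary_limit) (majorant 0).
- move=> n; apply: measurable_funTS; apply/measurable_EFinP.
  exact: cyl_fun_measurable (@cyl_fun_lacunary n).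
- apply: measurable_funTS; apply/measurable_EFinP.
  exact: measurable_lacunary_limit.
- have [m0 mu0] := haar_set1 (fun=> false).
  exists [set (fun=> false)]; split => // x /= nx; apply: contrapT => x0.
  by apply: nx => _; exact: lacunary_cvg.
- by apply: integrableS integrable_majorant.
- by apply/aeW => x n _; exact: lacunary_le.
Qed.

Lemma closed_by_lacunary : closed_by mu lacunary lacunary_limit.
Proof.
have ML := lacunary_martingale.
split; first by have [] := lacunary_dominated measurableT.
move=> n; split; first by move=> B _; exact: cyl_fun_zeta (@cyl_fun_lacunary n).
  exact: integrable_lacunary.
move=> A zA; have mA := measurable_zeta zA; have [intA cvgA] := lacunary_dominated mA.
(* For [A] in [zeta n] the integrals over [A] do not change from level [n] on. *)
rewrite -(cvg_lim _ cvgA)//; apply/esym/cvg_lim => //; apply: cvg_near_cst.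
exists n => // j /= nj; rewrite -(martingale_condexp mu_haar ML nj).
by have [_ _ ->] := condexpP mu_haar n (integrable_lacunary j).
Qed.

(** * Fourier coefficients and failure of convergence *)

(** The two Rademacher factors cancel, and the remaining Walsh function is 1 on the support of the
    peak. *)
Lemma fourier_bump n k : (2 ^ n <= k < 2 ^ n.+1)%N -> fourier mu (bump n) k = 1.
Proof.
move=> /andP[nk kn]; rewrite -(Rintegral_peak n); apply: eq_Rintegral => x _.
have k2 : (k - 2 ^ n < 2 ^ n)%N by move: kn; rewrite expnS; lia.
rewrite -(subnKC nk) walsh_pow2D// /bump mulrA -[_ * _ * rademacher n x]mulrA.
rewrite rademacherX2 mulr1 /peak indicE.
have [x0|x0] := pselect (cyl n (fun=> false) x); last first.
  by rewrite memNset// mulr0 mul0r.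
rewrite -(walsh_cyl k2 x0) (walsh_widen _ k2) big1 ?mulr1// => j _.
by rewrite /rademacher expr0 expr1n.
Qed.

Lemma lacunary_step i x :
  lacunary (N i).+1 x = lacunary (N i) x + lam i * bump (N i) x.
Proof.
rewrite (@lacunary_widen (N i).+1 (N i))//.
have iN : (i < (N i).+1)%N by rewrite ltnS leq_N.
rewrite /lacunary !(bigD1_seq i) ?mem_index_iota ?iota_uniq//=.
rewrite !condexp_bump ltnn leqnn mulr0 add0r addrC; congr +%R.
apply: eq_bigr => k ki; rewrite !condexp_bump.
case: (ltngtP k i) ki => // [/N_incr|/N_incr] Nki _.
  by rewrite (leqNgt (N i)) (leqNgt (N i).+1) ltnS (ltnW Nki) Nki.
by rewrite (ltnW Nki) Nki.
Qed.

(** Between levels [N i] and [(N i).+1] only [lam i * bump (N i)] is added, and level [N i] carries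
    no frequency from [2 ^ N i] on. *)
Lemma walsh_coef_lacunary i k : (2 ^ N i <= k < 2 ^ (N i).+1)%N ->
  walsh_coef mu lacunary k = lam i.
Proof.
move=> ik; have /andP[lk ki] := ik.
rewrite (walsh_coefE mu_haar lacunary_martingale ki).
have intb := integrable_bump (N i).
have -> : fourier mu (lacunary (N i).+1) k =
    fourier mu (lacunary (N i)) k + lam i * fourier mu (bump (N i)) k.
  rewrite /fourier -RintegralZl//; last exact: integrableMwalsh.
  rewrite -RintegralD//.
  - by apply: eq_Rintegral => x _; rewrite lacunary_step mulrDl mulrA.
  - by apply: integrableMwalsh; exact: integrable_lacunary.
  - by apply: integrableZl_EFin; exact: integrableMwalsh.
rewrite (fourier_ge_eq0 mu_haar (@cyl_fun_lacunary (N i)) lk).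
by rewrite fourier_bump// mulr1 add0r.
Qed.

(* Replacing the limit by its conditional expectation of level [N i + 1] only
   decreases the norm and leaves the finite sum of the [w_k], [a <= k < 2 ^ (N i + 1)]. *)
Lemma L1norm_lacunary_ge i a : (2 ^ N i <= a < 2 ^ (N i).+1)%N ->
  ((lam i * (((binary_variation a)%:R - 2) / 4))%:E <=
   L1norm mu (fun x => (partial_sum mu a lacunary x - lacunary_limit x)%R))%E.
Proof.
move=> ia; have /andP[la ai] := ia; have ML := lacunary_martingale.
have [intf cond_f] := closed_by_lacunary.
have cylS : cyl_fun (N i).+1 (partial_sum mu a lacunary).
  rewrite (partial_sumE mu_haar ML (ltnW ai)); apply: cyl_fun_fourier_sum.
  exact: ltnW.
have intS := integrable_cyl_fun mu cylS.
have intd : integ (fun x => partial_sum mu a lacunary x - lacunary_limit x).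
  exact: integrableB_EFin.
rewrite /L1norm -EFin_Rintegral; last exact: integrable_normr.
rewrite lee_fin; apply: le_trans (Rintegral_norm_condexp mu_haar (N i).+1 intd).
rewrite (condexpB mu_haar (N i).+1 intS intf) (condexp_id mu_haar cylS).
rewrite -(condexp_unique mu_haar (cond_f _)).
rewrite -(partial_sum_pow2 mu_haar (N i).+1 ML).
apply: (@le_trans _ _ (lam i * \int[mu]_x `|\sum_(a <= k < 2 ^ (N i).+1) walsh k x|)).
  by apply: ler_wpM2l => //; exact: L1_sum_walsh.
have intw : integ (fun x => `|\sum_(a <= k < 2 ^ (N i).+1) walsh k x|).
  apply: integrable_normr; apply: (@integrable_cyl_fun _ _ (N i).+1) => x y xy.
  by apply: eq_big_nat => k /andP[_ ki]; exact: walsh_cyl xy.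
rewrite -RintegralZl// le_eqVlt; apply/orP; left; apply/eqP.
apply: eq_Rintegral => x _; rewrite /partial_sum.
rewrite [X in _ - X](big_cat_nat (n := a)) ?(ltnW ai)//= opprD addrA subrr add0r.
rewrite normrN -{1}(ger0_norm (lam_ge0 i)) -normrM big_distrr/=; congr `|_|.
apply: eq_big_nat => k /andP[ak ki].
by rewrite (@walsh_coef_lacunary i)// (leq_trans la ak).
Qed.

End lacunary.

(** * Choice of the subsequence and conclusion *)

Lemma unbounded_variation_step (R : realType) (m : nat -> nat) :
  (forall k, (0 < m k)%N) -> {homo m : i j / (i < j)%N} ->
  ereal_sup (range (fun k => ((binary_variation (m k))%:R : R)%:E)) = +oo%E ->
  forall i, exists j, [/\ (i < j)%N, (top_digit (m i) < top_digit (m j))%N &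
    (2 * binary_variation (m i) <= binary_variation (m j))%N].
Proof.
move=> m0 m_incr supV i.
(* For [j >= n0] one has [j > i] and [m j >= j >= 2 ^ m i], whence
   [top_digit (m j) >= m i > top_digit (m i)]. *)
pose n0 := maxn i.+1 (2 ^ m i); pose B := (2 * binary_variation (m i))%N.
have [j n0j BV] : exists2 j, (n0 <= j)%N & (B <= binary_variation (m j))%N.
  (* Otherwise [B] plus the variations of the first [n0] terms would bound them all. *)
  apply: contrapT => nj; have bnd j :
      (binary_variation (m j) <= B + \sum_(k < n0) binary_variation (m k))%N.
    have [jn0|n0j] := ltnP j n0.
      by rewrite (bigD1 (Ordinal jn0))//= addnCA leq_addr.
    have [VB|BV] := leqP (binary_variation (m j)) B.
      exact: leq_trans VB (leq_addr _ _).
    by case: nj; exists j => //; exact: ltnW.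
  move: supV; apply/eqP; rewrite lt_eqF//.
  apply: le_lt_trans (ltry (B + \sum_(k < n0) binary_variation (m k))%N%:R).
  by apply: ge_ereal_sup => _ [j _ <-]; rewrite lee_fin ler_nat.
exists j; split => //; first by apply: leq_trans n0j; exact: leq_maxl.
have /andP[ti _] := top_digit_bounds (m0 i).
have /andP[_ tj] := top_digit_bounds (m0 j).
have m_ge k : (k <= m k)%N.
  by elim: k => // k IH; exact: leq_ltn_trans (m_incr _ _ (ltnSn k)).
have mij : (2 ^ m i < 2 ^ (top_digit (m j)).+1)%N.
  apply: leq_ltn_trans tj; apply: leq_trans (m_ge j).
  by apply: leq_trans n0j; exact: leq_maxr.
rewrite ltn_exp2l// ltnS in mij.
by apply: leq_trans mij; apply: leq_trans ti; exact: ltn_expl.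
Qed.

Lemma limn_esup_ge (R : realType) (u : nat -> \bar R) (c : \bar R) :
  (\forall k \near \oo, (c <= u k)%E) -> (c <= limn_esup u)%E.
Proof.
move=> cu; rewrite limn_esup_lim; apply: lime_ge; first exact: is_cvg_esups.
apply: filterS cu => k; move=> /le_trans; apply.
by apply: ereal_sup_ubound; exists k => /=.
Qed.

Theorem theorem5 (R : realType) (mu : probability dyadic R)
    (mu_haar : is_haar mu) :
  (forall (F : nat -> dyadic -> R) (m : nat -> nat),
     H1 mu F ->
     (forall k, (0 < m k)%N) ->
     elittleo (fun k => omega_H1 mu (top_digit (m k)) F)
              (fun k => (binary_variation (m k))%:R^-1) ->
     H1dist mu (m k) F @[k --> \oo] --> 0%E)
  /\
  (exists2 c : R, 0 < c &
     forall m : nat -> nat,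
       (forall k, (0 < m k)%N) ->
       {homo m : i j / (i < j)%N} ->
       ereal_sup (range (fun k => ((binary_variation (m k))%:R : R)%:E)) = +oo%E ->
       exists (F : nat -> dyadic -> R) (f : dyadic -> R) (s : nat -> nat),
         [/\ H1 mu F,
             closed_by mu F f,
             {homo s : i j / (i < j)%N},
             ebigO (fun k => omega_H1 mu (top_digit (m (s k))) F)
                   (fun k => (binary_variation (m (s k)))%:R^-1) &
             (c%:E < limn_esup (fun k =>
                L1norm mu (fun x => (partial_sum mu (m (s k)) F x - f x)%R)))%E]).
Proof.
split; first by move=> F m [MF _]; exact: H1_convergence.
(* Any positive number below 1/8 would do: [(V - 2) / (4 V)] is at least 1/8 once [V >= 4], which
   holds from [k = 2] on as [V k >= 2 ^ k]. *)
exists (16^-1); first by rewrite invr_gt0.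
move=> m m0 m_incr supV.
have [g gP] := choice (unbounded_variation_step m0 m_incr supV).
pose s k := iter k g 0%N.
have s_incr : {homo s : i j / (i < j)%N}.
  by apply: homo_ltn; [exact: ltn_trans|move=> k; have [] := gP (s k)].
pose V k := binary_variation (m (s k)).
pose N k := top_digit (m (s k)).
have N_incr : {homo N : i j / (i < j)%N}.
  by apply: homo_ltn; [exact: ltn_trans|move=> k; have [] := gP (s k)].
have V_gt0 k : (0 < V k)%N by exact: binary_variation_gt0.
have V2 k : (2 * V k <= V k.+1)%N by have [] := gP (s k).
have Vpow k : (2 ^ k <= V k)%N.
  elim: k => [|k IH]; first by rewrite V_gt0.
  by apply: leq_trans (V2 k); rewrite expnS leq_mul2l.
pose lam k : R := (V k)%:R^-1.
have lam_ge0 k : 0 <= lam k by rewrite invr_ge0.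
have lam_half k : lam k.+1 <= lam k / 2.
  rewrite /lam -invfM lef_pV2 ?posrE ?mulr_gt0 ?ltr0n//.
  by rewrite -(natrM R _ 2) ler_nat mulnC.
have mN k : (2 ^ N k <= m (s k) < 2 ^ (N k).+1)%N by exact: top_digit_bounds.
exists (lacunary mu N lam), (lacunary_limit mu N lam), s; split => //.
- exact: H1_lacunary.
- exact: closed_by_lacunary.
- exists 2; apply: nearW => k; rewrite ger0_norm ?invr_ge0//.
  rewrite gee0_abs; first exact: omega_H1_lacunary.
  by apply: integral_ge0 => x _; exact: maximal_fun_ge0.
- apply: (@lt_le_trans _ _ (8^-1)%:E).
    by rewrite lte_fin ltf_pV2 ?posrE// ltr_nat.
  apply: limn_esup_ge; exists 2%N => // k /= k2.
  apply: le_trans (L1norm_lacunary_ge mu_haar N_incr lam_ge0 lam_half (mN k)).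
  have V4 : 4 <= (V k)%:R :> R.
    rewrite (ler_nat R 4); apply: leq_trans (Vpow k).
    by rewrite (@leq_pexp2l 2 2).
  rewrite lee_fin /lam -/(V k) mulrC ler_pdivlMr ?ltr0n//.
  by move: V4; set v := (V k)%:R; lra.
Qed.
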